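(* Let $L$ be a finite $CW$-complex and let $F\colon X\to Y$ be a multivalued mapping of a paracompact $C$-space $X$ of extension dimension $\text{e-dim}\, X\le [L]$ to a topological space $Y$. If $F$ admits an infinite fiberwise $[L]_c$-connected filtration $\{F_i\}_{i\ge 0}$ of strongly lower semicontinuous multivalued mappings $F_i\colon X\to Y$, then $F$ has a singlevalued continuous selection, i.e. there is a continuous map $f\colon X\to Y$ with $f(x)\in F(x)$ for every $x\in X$.
   Context: A multivalued mapping $F\colon X\to Y$ assigns to each $x\in X$ a nonempty subset $F(x)\subset Y$. For a $CW$-complex $L$, a space $X$ has extension dimension $\le [L]$, written $\text{e-dim}\, X\le [L]$, if every (continuous) mapping of a closed subspace $A\subset X$ into $L$ admits an extension to a mapping of the whole space $X$ into $L$. A topological space $X$ is a $C$-space if for each sequence $\{\omega_i\}_{i\ge 1}$ of open covers of $X$ there is an open cover $\Sigma$ of $X$ of the form $\Sigma=\bigcup_{i=1}^\infty \sigma_i$ such that for each $i\ge 1$, $\sigma_i$ is a pairwise disjoint collection which refines $\omega_i$ (each element of $\sigma_i$ is contained in some element of $\omega_i$). A multivalued mapping $F\colon X\to Y$ is strongly lower semicontinuous if for any point $x\in X$ and any compact set $K\subset F(x)$ there exists a neighborhood $V$ of $x$ such that $K\subset F(z)$ for every $z\in V$. A sequence of multivalued mappings $\{F_i\colon X\to Y\}$ is a filtration of a multivalued mapping $F\colon X\to Y$ if for every $x\in X$ the sets $F_i(x)$ form an increasing sequence $F_0(x)\subset F_1(x)\subset\dots\subset F(x)$ of subspaces of $F(x)$.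 A pair of spaces $V\subset U$ is $[L]_c$-connected if for every compact metric space $T$ with $\text{e-dim}\, T\le [L]$ and for every closed subspace $A\subset T$ any mapping of $A$ into $V$ can be extended to a mapping of $T$ into $U$. A filtration $\{F_i\colon X\to Y\}$ of multivalued mappings is fiberwise $[L]_c$-connected if for any point $x\in X$ and any $i$ the pair $F_i(x)\subset F_{i+1}(x)$ is $[L]_c$-connected. *)

(* Defs.v *)
From HB Require Import structures.
From mathcomp Require Import all_boot all_order all_algebra.
From mathcomp Require Import all_classical all_reals all_analysis.

Set Implicit Arguments.
Unset Strict Implicit.
Unset Printing Implicit Defensive.

Import Order.TTheory GRing.Theory Num.Theory.
Import numFieldNormedType.Exports.

Local Open Scope classical_set_scope.
Local Open Scope ring_scope.

(** Finite CW-complexes *)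

(* Euclidean discs: the library norm on row vectors is the sup norm, hence the
   explicit sums of squares.  For n = 0 both discs are the one-point space and
   the sphere is empty. *)
Definition closed_disc (R : realType) (n : nat) : set 'rV[R]_n :=
  [set v | \sum_j v 0 j ^+ 2 <= 1].

Definition open_disc (R : realType) (n : nat) : set 'rV[R]_n :=
  [set v | \sum_j v 0 j ^+ 2 < 1].

Definition unit_sphere (R : realType) (n : nat) : set 'rV[R]_n :=
  [set v | \sum_j v 0 j ^+ 2 = 1].

Arguments closed_disc : clear implicits.
Arguments open_disc : clear implicits.
Arguments unit_sphere : clear implicits.

(* J. H. C. Whitehead's definition by characteristic maps.  A characteristic
   map is a total function of which only the values on the closed disc matter.
   [cw_inj] and [cw_open] say that it restricts to a homeomorphism of the open
   disc onto its image, the open cell.  For finitely many cells, closure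
   finiteness and the weak topology condition hold automatically. *)
Record finite_CW_complex (R : realType) (L : topologicalType) := FiniteCW {
  cw_cell : finType;
  cw_dim : cw_cell -> nat;
  cw_map : forall i : cw_cell, 'rV[R]_(cw_dim i) -> L;
  cw_open_cell := fun i : cw_cell => @cw_map i @` open_disc R (cw_dim i);
  cw_hausdorff : hausdorff_space L;
  cw_continuous : forall i : cw_cell,
    {within closed_disc R (cw_dim i), continuous (@cw_map i)};
  cw_inj : forall i : cw_cell, set_inj (open_disc R (cw_dim i)) (@cw_map i);
  cw_open : forall (i : cw_cell) (U : set 'rV[R]_(cw_dim i)),
    open U -> exists2 W : set L, open W &
      @cw_map i @` (U `&` open_disc R (cw_dim i)) = W `&` cw_open_cell i;
  cw_disjoint : trivIset [set: cw_cell] cw_open_cell;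
  cw_cover : \bigcup_(i in [set: cw_cell]) cw_open_cell i = [set: L];
  cw_boundary : forall i : cw_cell,
    @cw_map i @` unit_sphere R (cw_dim i) `<=`
      \bigcup_(j in [set j | (cw_dim j < cw_dim i)%N]) cw_open_cell j
}.

Arguments cw_map {R L} f i _.

(** Open covers, paracompact spaces and C-spaces *)

Definition open_cover (X : topologicalType) (C : set (set X)) : Prop :=
  (forall U, C U -> open U) /\ \bigcup_(U in C) U = [set: X].

Definition refines (X : Type) (C D : set (set X)) : Prop :=
  forall U, C U -> exists2 V, D V & U `<=` V.

Definition locally_finite (X : topologicalType) (C : set (set X)) : Prop :=
  forall x : X, exists2 W : set X, nbhs x W &
    finite_set [set U | C U /\ U `&` W !=set0].

(* Paracompact spaces are Hausdorff by convention. *)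
Definition paracompact (X : topologicalType) : Prop :=
  hausdorff_space X /\
  forall C : set (set X), open_cover C ->
    exists D : set (set X), [/\ open_cover D, refines D C & locally_finite D].

Definition C_space (X : topologicalType) : Prop :=
  forall omega : nat -> set (set X), (forall i, open_cover (omega i)) ->
    exists sigma : nat -> set (set X),
      [/\ open_cover (\bigcup_i sigma i),
          forall i, trivIset (sigma i) id
        & forall i, refines (sigma i) (omega i)].

(** Extension dimension *)

(* Maps out of a closed subspace are functions on the subtype, not total
   functions: the empty map into an empty space has to be taken into account. *)
Definition edim_le (X L : topologicalType) : Prop :=
  forall (A : set X) (f : A -> L), closed A -> continuous f ->
    exists2 g : X -> L, continuous g & forall a : A, g (set_val a) = f a.

(** Multivalued mappings *)

Definition multivalued (X Y : Type) (F : X -> set Y) : Prop :=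
  forall x, F x !=set0.

(* Compact sets are not required to be Hausdorff. *)
Definition strongly_lsc (X Y : topologicalType) (F : X -> set Y) : Prop :=
  forall (x : X) (K : set Y), compact K -> K `<=` F x ->
    \forall z \near x, K `<=` F z.

Definition filtration (X Y : Type) (Fi : nat -> X -> set Y) (F : X -> set Y) :
    Prop :=
  forall x, (forall i, Fi i x `<=` Fi i.+1 x) /\ (forall i, Fi i x `<=` F x).

Definition Lc_connected (R : realType) (L Y : topologicalType) (V U : set Y) :
    Prop :=
  forall T : metricType R, compact [set: T] -> edim_le T L ->
    forall (A : set T) (f : A -> V), closed A -> continuous f ->
      exists2 g : T -> U, continuous g &
        forall a : A, set_val (g (set_val a)) = set_val (f a).

Definition fiberwise_Lc_connected (R : realType) (L X Y : topologicalType)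
    (Fi : nat -> X -> set Y) : Prop :=
  forall (x : X) (i : nat), Lc_connected R L (Fi i x) (Fi i.+1 x).

Definition continuous_selection (X Y : topologicalType) (F : X -> set Y)
    (f : X -> Y) : Prop :=
  continuous f /\ forall x, F x (f x).

(* Main.v *)
Require Import Defs.
From HB Require Import structures.
From mathcomp Require Import all_boot all_order all_algebra.
From mathcomp Require Import all_classical all_reals all_analysis.
From mathcomp Require Import ring lra.

(* The selection is glued from maps out of one universal compactum [T].

   Universal compactum.  A finite CW complex [L] embeds in some R^m as a
   neighbourhood retract: its cells are attached one at a time, and a point near
   the larger complex is sent to the new cell, to the old complex, or to an
   interpolation between the two, according to how its distance to the new cell
   compares with its distance to the old complex.  Inside the compact space of
   sequences ((q_k, l_k)) in ([0,1] x L)^N, let [T] be the set where [l_k] agrees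
   with the retraction of [c_k(q, l_0, ..., l_(k-1))] whenever this value is close
   to [L], for a sequence [c_k] of R^m-valued functions that is dense and repeats
   each of its members infinitely often.  A map from a closed subset of [T] to [L]
   is close to some [c_k], hence extends because [l_k] does: e-dim T <= [L].
   Choosing the [l_k] successively, every map X -> [0,1]^N lifts to [T] as soon as
   e-dim X <= [L].

   Selection.  Level by level, choose locally finite covers (U_i y) of X indexed
   by X, and for every finite chain of indices, with at most one index at each
   level, a map T -> Y landing in the values of some F_n over the intersection of
   the closures.  Chains and subchains give equal maps over the corresponding
   faces of [0,1]^N.  At a new level only finitely many chains are relevant near a
   given point x, so that finitely many extensions along F_n(x) in F_(n+1)(x)
   yield compact sets, which strong lower semicontinuity spreads to a
   neighbourhood of x.  The C-space property applied to these covers provides at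
   most one set of each level around a point; Urysohn functions of a shrinking of
   the resulting countable cover map X to [0,1]^N, and the maps attached to the
   chains, composed with the lift X -> T, fit together. *)

Set Implicit Arguments.
Unset Strict Implicit.
Unset Printing Implicit Defensive.

Import Order.TTheory GRing.Theory Num.Theory.
Import numFieldNormedType.Exports.

Local Open Scope classical_set_scope.
Local Open Scope ring_scope.

(** * Paracompact spaces *)

Lemma filter_finite_bigcap (T : Type) (I : choiceType) (F : set_system T)
    (A : set I) (P : I -> set T) : Filter F -> finite_set A ->
  (forall i, A i -> F (P i)) -> F (\bigcap_(i in A) P i).
Proof.
move=> FF fA FP; apply: filterS (@filter_bigI T I (fset_set A) P F FF _).
  by move=> t H i Ai; apply: H; rewrite /= in_fset_set// inE.
by move=> i; rewrite in_fset_set// inE => /FP.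
Qed.

Definition locally_finite_family (X : topologicalType) (I : Type)
    (U : I -> set X) : Prop :=
  forall x : X, exists2 N : set X, nbhs x N &
    finite_set [set i | U i `&` N !=set0].

Lemma locally_finite_family_reindex (X : topologicalType) (D : set (set X))
    (I : Type) (d : set X -> I) (T : set (set X)) :
  locally_finite D -> T `<=` D ->
  locally_finite_family (fun i => \bigcup_(U in [set U | T U /\ d U = i]) U).
Proof.
move=> lfD TD x; have [W nW fW] := lfD x; exists W => //.
apply: (sub_finite_set _ (finite_image d fW)) => i [y [[U [TU <-] Uy] Wy]].
by exists U => //; split; [exact: TD|exists y].
Qed.

Lemma closure_locally_finite (X : topologicalType) (I : Type)
    (U : I -> set X) :
  locally_finite_family U -> locally_finite_family (closure \o U).
Proof.
move=> lfU x; have [N /nbhs_interior nN fN] := lfU x; exists N° => //.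
apply: (sub_finite_set _ fN) => i [y [cy Ny]].
by have [z [Uz Nz]] := cy _ Ny; exists z.
Qed.

(** Only finitely many members meet some neighbourhood of [x]; intersecting it with the open
    complements of those that miss [x] leaves only members through [x]. *)
Lemma locally_finite_nbhs (X : topologicalType) (I : choiceType)
    (C : I -> set X) (x : X) : locally_finite_family C ->
  (forall i, closed (C i)) -> \forall z \near x, forall i, C i z -> C i x.
Proof.
move=> lfC clC; have [N nN fN] := lfC x.
pose J := [set i | C i `&` N !=set0] `&` [set i | ~ C i x].
have : nbhs x (\bigcap_(i in J) ~` C i).
  apply: filter_finite_bigcap; first exact: finite_setIl.
  move=> i [_ /= nCx]; apply: open_nbhs_nbhs; split => //.
  exact: closed_openC.
apply: filterS2 nN => z Nz Jz i Ciz; apply: contrapT => nCix.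
by apply: (Jz i) => //; split => //; exists z.
Qed.

Lemma closed_locally_finite_bigcup (X : topologicalType) (I : choiceType)
    (C : I -> set X) : locally_finite_family C -> (forall i, closed (C i)) ->
  closed (\bigcup_i C i).
Proof.
move=> lfC clC x cx.
by have [z [[i _ Ciz]] /(_ i Ciz)] := cx _ (locally_finite_nbhs x lfC clC); exists i.
Qed.

Lemma closure_locally_finite_bigcup (X : topologicalType) (I : choiceType)
    (U : I -> set X) : locally_finite_family U ->
  closure (\bigcup_i U i) `<=` \bigcup_i closure (U i).
Proof.
move=> lfU; have cl : closed (\bigcup_i (closure \o U) i).
  apply: closed_locally_finite_bigcup; first exact: closure_locally_finite.
  by move=> i; exact: closed_closure.
rewrite closureE; apply: smallest_sub => // x [i _ Ux].
by exists i => //; exact: subset_closure.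
Qed.

(** Regularity. Refine the cover by open sets that miss [B] or whose closure misses [x]. The
    refining members that meet [B] lie in sets of the second kind, and by local finiteness their
    closures have a closed union; its complement is [N]. *)
Lemma paracompact_separate (X : topologicalType) (x : X) (B : set X) :
  paracompact X -> closed B -> ~ B x ->
  exists2 N, nbhs x N & closure N `&` B = set0.
Proof.
move=> [hX pX] clB nBx.
pose C := [set V : set X | open V /\ (V `<=` ~` B \/ ~ closure V x)].
have [|D [oD DC lfD]] := pX C.
  split; first by move=> U [].
  apply/seteqP; split=> // y _; have [By|nBy] := pselect (B y); last first.
    exists (~` B) => //; split; last by left.
    exact: closed_openC.
  have xy : x != y by apply: contra_not_neq nBx => ->.
  move: hX; rewrite open_hausdorff => /(_ _ _ xy)[[P Q]] /=.
  rewrite !inE => -[Px Qy] [oP oQ PQ]; exists Q => //; split => //; right.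
  move=> /(_ P) -[|z [Qz Pz]]; first exact: open_nbhs_nbhs.
  by rewrite -[False]/(set0 z) -PQ.
pose T := [set U | D U /\ U `&` B !=set0].
(* Each set is its own index; indices outside [T] carry the empty set. *)
have lfT : locally_finite_family
    (fun V : set X => \bigcup_(U in [set U | T U /\ id U = V]) U).
  by apply: locally_finite_family_reindex lfD _ => U [].
pose N := ~` \bigcup_V closure (\bigcup_(U in [set U | T U /\ id U = V]) U).
have oN : open N.
  apply: closed_openC; apply: closed_locally_finite_bigcup.
    exact: closure_locally_finite lfT.
  by move=> V; exact: closed_closure.
exists N.
  apply: open_nbhs_nbhs; split => // -[V _].
  have [TV|nTV] := pselect (T V); last first.
    rewrite (_ : \bigcup_(U in _) U = set0) ?closure0// -subset0 => y.
    by case=> U [/= + UV]; rewrite UV.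
  rewrite (_ : \bigcup_(U in _) U = V); last first.
    by apply/seteqP; split => y; [case=> U [_ /= ->]|exists V].
  have [DV [b [Vb Bb]]] := TV.
  have [W [_ [WB|nW]] VW] := DC _ DV; first by move: (VW _ Vb) => /WB.
  by move=> /(closureS VW).
rewrite -subset0 => b [cb Bb].
have [V DV Vb] : (\bigcup_(U in D) U) b by case: oD => _ ->.
have nV : nbhs b V by apply: open_nbhs_nbhs; split => //; case: oD => + _; exact.
have [z [+ Vz]] := cb _ nV; apply; exists V => //; apply: subset_closure.
by exists V => //; split => //; split => //; exists b.
Qed.

(* The index set is kept, so the refining family may have empty members. *)
Lemma paracompact_shrinking (X : topologicalType) (I : choiceType)
    (S : I -> set X) : paracompact X ->
  (forall i, open (S i)) -> \bigcup_i S i = setT ->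
  exists U : I -> set X, [/\ forall i, open (U i), \bigcup_i U i = setT,
    forall i, closure (U i) `<=` S i & locally_finite_family U].
Proof.
move=> pX oS cS.
pose C := [set V : set X | open V /\ exists i, closure V `<=` S i].
have [|D [oD DC lfD]] := pX.2 C.
  split; first by move=> U [].
  apply/seteqP; split=> // y _.
  have [i _ Siy] : (\bigcup_i S i) y by rewrite cS.
  have clS : closed (~` S i) by exact: open_closedC.
  have [|N nN NS] := paracompact_separate (x := y) pX clS; first by apply.
  exists N°; last by [].
  split; first exact: open_interior.
  exists i; apply: subset_trans (closureS (@interior_subset _ N)) _.
  by move=> z Nz; apply: contrapT => nS; rewrite -[False]/(set0 z) -NS.
have [[i0]|noI] := pselect (inhabited I); last first.
  have X0 (x : X) : False.
    have [i _ _] : (\bigcup_i S i) x by rewrite cS.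
    by apply: noI; exists.
  exists (fun _ => set0); split=> [i||i|x]; last by case: (X0 x).
  - exact: open0.
  - by apply/seteqP; split => // x; case: (X0 x).
  - by rewrite closure0.
(* Every member of the refinement is assigned to one index; the new family collects the members with
   the same [d V]. *)
have /choice[d dP] V : exists i, D V -> closure V `<=` S i.
  have [DV|nDV] := pselect (D V); last by exists i0.
  have [W [_ [i Wi]] VW] := DC _ DV.
  by exists i => _; apply: subset_trans (closureS VW) Wi.
exists (fun i => \bigcup_(V in [set V | D V /\ d V = i]) V); split.
- by move=> i; apply: bigcup_open => V [DV _]; case: oD => + _; apply.
- apply/seteqP; split => // x _.
  have [V DV Vx] : (\bigcup_(U in D) U) x by case: oD => _ ->.
  by exists (d V) => //; exists V.
(* The union is regrouped as a locally finite family indexed by sets, so that the closure can be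
   taken member by member. *)
- move=> i x.
  have lf : locally_finite_family
      (fun V : set X => \bigcup_(U in [set U | D U /\ d U = i /\ U = V]) U).
    move=> y; have [W nW fW] := lfD y; exists W => //.
    apply: (sub_finite_set _ fW) => V [z [[U [DU [_ <-]] Uz] Wz]].
    by split => //; exists z.
  have -> : \bigcup_(V in [set V | D V /\ d V = i]) V =
      \bigcup_V \bigcup_(U in [set U | D U /\ d U = i /\ U = V]) U.
    apply/seteqP; split => y; first by case=> V [DV dV] Vy; exists V => //; exists V.
    by case=> V _ [U [DU [dU _]] Uy]; exists U.
  move=> /(closure_locally_finite_bigcup lf)[V _ cx].
  have [[DV dV]|nDV] := pselect (D V /\ d V = i).
    rewrite -dV; apply: (dP V DV); apply: closureS cx.
    by move=> y [U [_ [_ <-]]].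
  move: cx; rewrite (_ : \bigcup_(_ in _) _ = set0) ?closure0//.
  by apply/seteqP; split => // y [U [DU [dU UV]] _]; apply: nDV; rewrite -UV.
- exact: locally_finite_family_reindex.
Qed.

(** Shrink the cover by the complements of [A] and [B]: the complements of the two closures are the
    separating sets. *)
Lemma paracompact_normal (R : realType) (X : topologicalType) :
  paracompact X -> normal_space X.
Proof.
move=> pX; apply/(@normal_openP R) => A B clA clB AB.
have [||U [oU cU US _]] :=
    @paracompact_shrinking X bool (fun b => if b then ~` A else ~` B) pX.
- by case; exact: closed_openC.
- apply/seteqP; split => // x _.
  have [Ax|nAx] := pselect (A x); last by exists true.
  by exists false => // Bx; rewrite -[False]/(set0 x) -AB.
exists (~` closure (U true)), (~` closure (U false)); split.
- by apply: closed_openC; exact: closed_closure.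
- by apply: closed_openC; exact: closed_closure.
- by move=> x Ax /(US true).
- by move=> x Bx /(US false).
- apply/seteqP; split => // x [n1 n2].
  have [[] _ Ux] : (\bigcup_i U i) x by rewrite cU.
    by apply: n1; exact: subset_closure.
  by apply: n2; exact: subset_closure.
Qed.

(** * Selections over the faces of a universal compactum *)

Lemma prefix_choice (A : Type) (a0 : A) (P : nat -> (nat -> A) -> Prop) :
  (forall k l l', (forall j, (j <= k)%N -> l j = l' j) -> P k l -> P k l') ->
  (forall k l, (forall j, (j < k)%N -> P j l) ->
    exists a, P k (fun j => if (j < k)%N then l j else a)) ->
  exists l, forall k, P k l.
Proof.
move=> Pext Pstep.
have /choice[F FP] (kl : nat * (nat -> A)) :
    exists a, (forall j, (j < kl.1)%N -> P j kl.2) ->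
      P kl.1 (fun j => if (j < kl.1)%N then kl.2 j else a).
  have [H|nH] := pselect (forall j, (j < kl.1)%N -> P j kl.2).
    by have [a] := Pstep _ _ H; exists a.
  by exists a0.
(* [s k] is right below [k] and provisional from there on; later stages agree with it below [k], and
   the diagonal is the sequence sought. *)
pose s := fix s k := if k is k'.+1 then
  fun j => if (j < k')%N then s k' j else F (k', s k') else fun=> a0.
have sE k d j : (j < k)%N -> s (k + d)%N j = s k j.
  move=> jk; elim: d => [|d IH]; first by rewrite addn0.
  by rewrite addnS /= ltn_addr.
have sP k : forall j, (j < k)%N -> P j (s k).
  elim: k => // k IH j; rewrite ltnS leq_eqVlt => /orP[/eqP->|jk].
    exact: (FP (k, s k)).
  apply: Pext (IH _ jk) => m mj; rewrite /= ifT//.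
  exact: leq_ltn_trans jk.
exists (fun j => s j.+1 j) => k.
apply: Pext (sP k.+1 k (leqnn _)) => j jk.
by rewrite -(subnKC (_ : (j.+1 <= k.+1)%N))// sE.
Qed.

Lemma within_finite_bigcup_continuous (T U : topologicalType) (I : choiceType)
    (A : set I) (C : I -> set T) (f : T -> U) : finite_set A ->
  (forall i, A i -> closed (C i)) ->
  (forall i, A i -> {within C i, continuous f}) ->
  {within \bigcup_(i in A) C i, continuous f}.
Proof.
move=> fA clC cf; rewrite -bigsetU_fset_set//.
have : forall i, i \in (finmap.enum_fset (fset_set A)) -> A i.
  by move=> i; rewrite in_fset_set// inE.
elim: (finmap.enum_fset (fset_set A)) => [|i s IH] sA.
  by rewrite big_nil; exact: continuous_subspace0.
rewrite big_cons; apply: withinU_continuous.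
- by apply: clC; apply: sA; rewrite mem_head.
- by apply: closed_bigsetU => j js; apply: clC; apply: sA; rewrite inE js orbT.
- by apply: cf; apply: sA; rewrite mem_head.
- by apply: IH => j js; apply: sA; rewrite inE js orbT.
Qed.

Lemma within_eq_continuous (T U : topologicalType) (A : set T) (f g : T -> U) :
  (forall x, A x -> f x = g x) -> continuous f -> {within A, continuous g}.
Proof.
move=> fg cf; apply: (@subspace_eq_continuous _ _ _ f).
  by move=> x /set_mem /fg.
exact: continuous_subspaceT.
Qed.

Lemma within_comp_continuous (T W Z : topologicalType) (U : set W) (g : W -> Z)
    (f : T -> W) : {within U, continuous g} -> continuous f ->
  (forall t, U (f t)) -> continuous (g \o f).
Proof.
move=> cg cf fU t N nN; move/subspace_continuousP : cg => /(_ _ (fU t) N nN) wN.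
have H : nbhs t (f @^-1` (fun w => U w -> N (g w))) := cf t _ wN.
rewrite nbhs_simpl /=; apply: (@filterS _ (nbhs t) _ _ _ _ H) => s Ns.
exact: Ns (fU s).
Qed.

Lemma Lc_connected_extend (R : realType) (L Y : topologicalType)
    (V U : set Y) (T : metricType R) (B : set T) (b : T -> Y) :
  Lc_connected R L V U -> compact [set: T] -> edim_le T L ->
  closed B -> {within B, continuous b} -> (forall t, B t -> V (b t)) ->
  exists g : T -> Y, [/\ continuous g, forall t, U (g t) &
    forall t, B t -> g t = b t].
Proof.
move=> VU cT dT clB cb bV.
pose f (a : B) : V := SigSub (mem_set (bV _ (set_mem (valP a)))).
have cf : continuous f.
  apply: (@continuous_comp_initial _ _ _ set_val).
  by move/subspace_sigL_continuousP: cb; apply.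
have [g cg gf] := VU T cT dT B f clB cf.
exists (fun t => set_val (g t)); split.
- move=> t; apply: continuous_comp; first exact: cg.
  exact: initial_continuous.
- by move=> t; exact: (set_mem (valP (g t))).
- by move=> t Bt; have := gf (SigSub (mem_set Bt)).
Qed.

(** * Coherent families of maps attached to chains of indices *)

Section selection.
Variables (R : realType) (L X Y : topologicalType) (Fi : nat -> X -> set Y).
Variables (y0 : Y) (T : metricType R) (p : nat -> T -> R).
Hypothesis Fi_le : forall x i j, (i <= j)%N -> Fi i x `<=` Fi j x.
Hypothesis Fi_conn : fiberwise_Lc_connected R L Fi.
Hypothesis Fi_lsc : forall i, strongly_lsc (Fi i).
Hypothesis pX : paracompact X.
Hypothesis T_compact : compact [set: T].
Hypothesis T_dim : edim_le T L.
Hypothesis p_cont : forall n, continuous (p n).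

(** The part of [T] over a face of the cube, [p n] being the [n]-th coordinate. Asking for a
    coordinate equal to 1 keeps away from the origin and makes the face over the empty set empty. *)
Definition face (A : set nat) : set T :=
  [set t | (forall j, p j t != 0 -> A j) /\ exists j, p j t = 1].

Lemma face_closed (A : set nat) : finite_set A -> closed (face A).
Proof.
move=> fA.
have -> : face A = (\bigcap_(j in ~` A) p j @^-1` [set 0]) `&`
                 \bigcup_(j in A) p j @^-1` [set 1].
  apply/seteqP; split => t.
    move=> [tA [j tj]]; split; last first.
      by exists j => //; apply: tA; rewrite tj oner_neq0.
    by move=> k nAk; apply/eqP; apply: contrapT => /negP/tA.
  move=> [t0 [j Aj tj]]; split; last by exists j.
  by move=> k; apply: contraPP => nAk; rewrite (t0 k nAk) eqxx.
apply: closedI.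
  apply: closed_bigI => j _; apply: closed_comp => [t _|]; first exact: p_cont.
  exact: closed_eq.
apply: closed_bigcup => // j _; apply: closed_comp => [t _|]; first exact: p_cont.
exact: closed_eq.
Qed.

Lemma faceS A B : A `<=` B -> face A `<=` face B.
Proof. by move=> AB t [tA t1]; split => // j /tA /AB. Qed.

(** The simplices of the construction: at each level, either [None] or the index of one member of
    the cover of that level. *)
Definition chain := nat -> option X.
Implicit Types (c : chain) (U : nat -> X -> set X).

Definition level n c := forall j, (n <= j)%N -> c j = None.
Definition dom c : set nat := [set j | c j].
Definition subchain c' c := forall j y, c' j = Some y -> c j = Some y.
Definition cell U c : set X :=
  [set z | forall j y, c j = Some y -> closure (U j y) z].
Definition del c i : chain := fun j => if j == i then None else c j.
Definition chain_size n c := (\sum_(j < n) c j)%N.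

Lemma level_dom n c j : level n c -> dom c j -> (j < n)%N.
Proof.
by move=> lc; rewrite ltnNge /dom /=; apply: contraTN => /lc ->.
Qed.

Lemma finite_dom n c : level n c -> finite_set (dom c).
Proof.
move=> lc; apply: (sub_finite_set _ (finite_II n)) => j.
exact: level_dom.
Qed.

Lemma subchain_dom c' c : subchain c' c -> dom c' `<=` dom c.
Proof.
move=> cc j; rewrite /dom /=; case E: (c' j) => [y|]// _.
by rewrite (cc _ _ E).
Qed.

Lemma subchain_level n c' c : subchain c' c -> level n c -> level n c'.
Proof. by move=> cc lc j /lc; case E: (c' j) => [y|]//; rewrite (cc _ _ E). Qed.

Lemma subchain_cell U c' c : subchain c' c -> cell U c `<=` cell U c'.
Proof. by move=> cc z zc j y /cc /zc. Qed.

Lemma del_subchain c i : subchain (del c i) c.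
Proof. by move=> j y; rewrite /del; case: ifP. Qed.

Lemma subchain_del c' c i : subchain c' c -> c' i = None -> subchain c' (del c i).
Proof.
by move=> cc ci j y /[dup] /cc <-; rewrite /del; case: eqP => // ->; rewrite ci.
Qed.

Lemma subchain_neq c' c : subchain c' c -> c' != c -> exists2 j, c' j = None & dom c j.
Proof.
move=> cc; apply: contra_neqP => H; apply/funext => j.
case E: (c' j) => [y|]; first by rewrite (cc _ _ E).
case E' : (c j) => [y|]//; exfalso; apply: H; exists j => //.
by rewrite /dom /= E'.
Qed.

Lemma subchain_size n c' c : level n c -> subchain c' c -> c' != c ->
  (chain_size n c' < chain_size n c)%N.
Proof.
move=> lc cc /(subchain_neq cc)[j c'j cj].
have jn := level_dom lc cj; rewrite /chain_size.
rewrite (bigD1 (Ordinal jn))//= [ltnRHS](bigD1 (Ordinal jn))//= c'j add0n.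
rewrite (_ : isSome (c j) = true)// add1n ltnS; apply: leq_sum => k _.
by case E: (c' k) => [y|]//; rewrite (cc _ _ E).
Qed.

Lemma chain_size_le n c : (chain_size n c <= n)%N.
Proof.
rewrite -[leqRHS]card_ord -sum1_card; apply: leq_sum => k _.
by case: (c k).
Qed.

Lemma level_cell U U' n c : level n c -> (forall j, (j < n)%N -> U j = U' j) ->
  cell U c `<=` cell U' c.
Proof.
move=> lc UU z zc j y cj; rewrite -UU; first exact: zc.
by apply: level_dom lc _; rewrite /dom /= cj.
Qed.

(* [g c] is defined on the whole of [T], but only its values on [face (dom c)]
   are constrained by the subchains of [c]. *)
Definition coherent i n U (g : chain -> T -> Y) :=
  forall c z, level i c -> cell U c z ->
  [/\ c != (fun=> None) -> continuous (g c),
      c != (fun=> None) -> forall t, Fi n z (g c t) &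
      forall c', subchain c' c -> forall t, face (dom c') t -> g c' t = g c t].

(** Keeps the levels at which [t] has a nonzero coordinate. It depends on [t] but on no chosen face,
    hence gives a single value where faces overlap. *)
Let restr c (t : T) : chain := fun j => if p j t == 0 then None else c j.

(** [G c] serves the chain [c] with the index [x] added at level [i]. The induction is on the number
    of entries of [c]: on the boundary of the enlarged face the map is forced by [g c] and by the
    smaller chains, and filling it in costs one step of the filtration. *)
Lemma coherent_extend i n U g (x : X) k : coherent i n U g ->
  exists G : chain -> T -> Y, forall c, level i c -> cell U c x ->
    (chain_size i c < k)%N ->
  [/\ continuous (G c), forall t, Fi (n + k)%N x (G c t),
      forall t, face (dom c) t -> G c t = g c t &
      forall c', subchain c' c ->
        forall t, face (dom c' `|` [set i]) t -> G c' t = G c t].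
Proof.
move=> Ig; elim: k => [|k [G GP]].
  by exists (fun _ _ => y0).
have restrP c t : face (dom c `|` [set i]) t ->
    face (dom (restr c t) `|` [set i]) t.
  move=> [tc t1]; split=> // j tj; have [cj|] := tc j tj; last by right.
  by left; rewrite /restr /dom /= (negbTE tj).
have restr_sub c t : subchain (restr c t) c.
  by move=> j y; rewrite /restr; case: ifP.
have /choice[h hP] c : exists h : T -> Y,
    level i c -> cell U c x -> chain_size i c = k ->
  [/\ continuous h, forall t, Fi (n + k.+1)%N x (h t),
      forall t, face (dom c) t -> h t = g c t &
      forall c', subchain c' c -> c' != c ->
        forall t, face (dom c' `|` [set i]) t -> G c' t = h t].
  have [[lc cx ck]|nc] := pselect [/\ level i c, cell U c x & chain_size i c = k];
    last first.
    by exists (g c) => lc cx ck; case: nc.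
  have ltk c' : subchain c' c -> c' != c -> (chain_size i c' < k)%N.
    by rewrite -ck; exact: subchain_size.
  have [cg gF gS] := Ig _ _ lc cx.
  have dom0 t : face (dom c) t -> c != (fun=> None).
    move=> [+ [j tj]] => /(_ j); rewrite tj oner_neq0 => /(_ isT).
    by apply: contraTneq => ->.
  have ci : c i = None by exact: lc.
  (* [B] is the boundary of the face over [dom c] and the new level [i]: the side opposite [i] and,
     for each [j] in [dom c], the side [D j] opposite [j]. *)
  pose D j := face (dom (del c j) `|` [set i]).
  pose B := face (dom c) `|` \bigcup_(j in dom c) D j.
  pose b t := if `[< face (dom c) t >] then g c t else G (restr c t) t.
  have finD j : finite_set (dom (del c j) `|` [set i]).
    rewrite finite_setU; split; last exact: finite_set1.
    exact/finite_dom/(subchain_level (@del_subchain c j) lc).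
  have clD j : closed (D j) by exact: face_closed.
  have clc : closed (face (dom c)) by apply: face_closed; exact: finite_dom lc.
  have del_neq j : dom c j -> del c j != c.
    by apply: contraTneq => <-; rewrite /dom /del /= eqxx.
  have restr_del j t : D j t -> dom c j -> subchain (restr c t) (del c j).
    move=> [tD _] cj; apply: subchain_del => //.
    rewrite /restr; case: eqP => // /eqP /tD [|/= ji]; first by rewrite /dom /del /= eqxx.
    by rewrite ji.
  (* A point of [D j] in [face (dom c)] has zero [i]-th coordinate, as [i] is not in [dom c]; there
     [G] and [g] agree. Elsewhere [restr c t] is a subchain of [del c j], and coherence of [G]
     applies. *)
  have bD j t : dom c j -> D j t -> b t = G (del c j) t.
    move=> cj Dt; have dc := @del_subchain c j.
    have [_ _ Gg GG] := GP _ (subchain_level dc lc) (subchain_cell dc cx)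
      (ltk _ dc (del_neq j cj)).
    rewrite /b; case: asboolP => [tc|_].
      have td : face (dom (del c j)) t.
        have [tc1 t1] := tc; have [tD _] := Dt; split => // m tm.
        have [//|/= mi] := tD m tm.
        by have := tc1 m tm; rewrite mi /dom /= ci.
      by rewrite Gg//; apply/esym/gS.
    apply: GG; first exact: restr_del.
    by apply: restrP; apply: faceS Dt => m [dm|->]; [left; exact: subchain_dom dm|right].
  have clB : closed B.
    by apply: closedU => //; apply: closed_bigcup => //; exact: finite_dom lc.
  have cb : {within B, continuous b}.
    apply: withinU_continuous => //.
    - by apply: closed_bigcup => //; exact: finite_dom lc.
    - have [->|/set0P[t0 t0c]] := eqVneq (face (dom c)) set0.
        exact: continuous_subspace0.
      apply: (@within_eq_continuous _ _ _ (g c)); last by apply: cg; exact: dom0 t0c.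
      by move=> t tc; rewrite /b asboolT.
    - apply: within_finite_bigcup_continuous => //; first exact: finite_dom lc.
      move=> j cj; apply: (@within_eq_continuous _ _ _ (G (del c j))).
        by move=> t Dt; rewrite (bD j).
      have dc := @del_subchain c j.
      by have [] := GP _ (subchain_level dc lc) (subchain_cell dc cx)
        (ltk _ dc (del_neq j cj)).
  have bF t : B t -> Fi (n + k)%N x (b t).
    case=> [tc|[j cj Dt]].
      rewrite /b asboolT//.
      by apply: (Fi_le (leq_addr k n)); apply: gF; exact: dom0 tc.
    have dc := @del_subchain c j; rewrite (bD j)//.
    by have [_ + _ _] := GP _ (subchain_level dc lc) (subchain_cell dc cx)
        (ltk _ dc (del_neq j cj)); exact.
  have [h [ch hF hb]] :=
    Lc_connected_extend (@Fi_conn x (n + k)%N) T_compact T_dim clB cb bF.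
  exists h => _ _ _; split => //.
  - by move=> t; rewrite addnS; exact: hF.
  - by move=> t tc; rewrite hb /b ?asboolT//; left.
  - move=> c' cc ne t tc'; have [j c'j cj] := subchain_neq cc ne.
    have dc := @del_subchain c j.
    have Dt : D j t.
      apply: faceS tc' => m [cm|->]; last by right.
      by left; apply: subchain_dom cm; exact: subchain_del.
    rewrite hb ?(bD j)//; last by right; exists j.
    have [_ _ _ GG] := GP _ (subchain_level dc lc) (subchain_cell dc cx)
      (ltk _ dc (del_neq j cj)).
    by apply: GG tc'; exact: subchain_del.
exists (fun c => if (chain_size i c < k)%N then G c else h c) => c lc cx.
rewrite ltnS leq_eqVlt => /orP[/eqP ck|ck].
  have [ch hF hg hG] := hP c lc cx ck; rewrite ck ltnn; split => // c' cc t tc'.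
  have [->|ne] := eqVneq c' c; first by rewrite ck ltnn.
  by rewrite -{1}ck subchain_size// (hG _ cc ne).
rewrite ck; have [cG GF Gg GG] := GP c lc cx ck; split => //.
  by move=> t; rewrite addnS; exact: Fi_le (leqnSn _) _ (GF t).
move=> c' cc t tc'; rewrite ifT; first exact: GG.
have [->//|ne] := eqVneq c' c.
exact: ltn_trans (subchain_size lc cc ne) ck.
Qed.

Lemma level_del c i : level i.+1 c -> level i (del c i).
Proof.
move=> lc j ij; rewrite /del; have [//|ji] := eqVneq j i; apply: lc.
by rewrite ltn_neqAle eq_sym ji.
Qed.

(** A chain below level [i.+1] is a chain below level [i] with an optional entry at level [i], and
    local finiteness leaves finitely many entries at [x]. *)
Lemma finite_chains U i x :
  (forall j, (j < i)%N -> locally_finite_family (U j)) ->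
  finite_set [set c | level i c /\ cell U c x].
Proof.
elim: i => [|i IH] lfU.
  apply: (sub_finite_set _ (finite_set1 (fun=> None))) => c [lc _].
  by apply/funext => j; exact: lc.
have fO : finite_set (None |` [set Some y | y in [set y | closure (U i y) x]]).
  rewrite finite_setU; split; first exact: finite_set1.
  apply: finite_image.
  have [N nN fN] := closure_locally_finite (lfU i (ltnSn i)) x.
  apply: (sub_finite_set _ fN) => y xy; exists x; split => //.
  exact: nbhs_singleton.
have fI := finite_setX (IH (fun j ji => lfU j (ltnW ji))) fO.
apply: (sub_finite_set _
  (finite_image (fun co j => if j == i then co.2 else co.1 j) fI)).
move=> c [lc cx]; exists (del c i, c i).
  split; last first.
    rewrite /=; case E: (c i) => [y|]; last by left.
    by right; exists y => //; exact: cx E.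
  by split; [exact: level_del|exact: subchain_cell (@del_subchain c i) _ cx].
by apply/funext => j; rewrite /del /=; have [->|] := eqVneq j i.
Qed.

Lemma del_id c i : c i = None -> del c i = c.
Proof. by move=> ci; apply/funext => j; rewrite /del; have [->|] := eqVneq j i. Qed.

Lemma dom_del c i : dom c `<=` dom (del c i) `|` [set i].
Proof.
move=> j cj; have [->|ji] := eqVneq j i; first by right.
by left; rewrite /dom /del /= (negbTE ji).
Qed.

(** The finitely many maps [G x c] for chains through [x] have compact images in one value of the
    filtration at [x], so strong lower semicontinuity keeps them in the values at all points near
    [x]. The new cover shrinks these neighbourhoods, and its index [y] brings in the maps [G y]. *)
Lemma coherent_step i n U g :
  (forall j, (j < i)%N -> locally_finite_family (U j)) ->
  coherent i n U g ->
  exists V g', [/\ forall y, open (V y), \bigcup_y V y = setT,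
    locally_finite_family V, forall c, level i c -> g' c = g c &
    coherent i.+1 (n + i.+1)%N (fun j => if (j < i)%N then U j else V) g'].
Proof.
move=> lfU Ig.
(* A chain below level [i] has at most [i] entries, so [k = i.+1] covers them all. *)
have /choice[G GP] x := coherent_extend x i.+1 Ig.
(* The second clause forces chains through [z] below level [i] to pass through [x] too, where [G x]
   is controlled. *)
pose O x := [set z | (forall c, level i c -> cell U c x ->
    forall t, Fi (n + i.+1)%N z (G x c t)) /\
  forall j y, (j < i)%N -> closure (U j y) z -> closure (U j y) x].
have nO x : nbhs x (O x).
  apply: filterI.
    apply: (filterS _ (@filter_finite_bigcap _ _ (nbhs x) _ (fun c => [set z |
      forall t, Fi (n + i.+1)%N z (G x c t)]) _ (finite_chains x lfU) _)).
      by move=> z Hz c lc cx t; exact: Hz.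
    move=> c [lc cx].
    have [cG GF _ _] := GP x c lc cx (chain_size_le i c : (_ < i.+1)%N).
    have cK : compact (G x c @` setT).
      by apply: continuous_compact => //; exact: continuous_subspaceT.
    have KF : G x c @` setT `<=` Fi (n + i.+1)%N x by move=> _ [t _ <-].
    by apply: filterS (Fi_lsc cK KF) => z Kz t; apply: Kz; exists t.
  apply: (filterS _ (@filter_finite_bigcap _ _ (nbhs x) `I_i (fun j =>
    [set z | forall y, closure (U j y) z -> closure (U j y) x]) _ (finite_II i) _)).
    by move=> z Hz j y ji; exact: Hz.
  move=> j ji; apply: (locally_finite_nbhs (C := closure \o U j)).
    exact/closure_locally_finite/lfU.
  by move=> y; exact: closed_closure.
have [||V [oV cV VO lfV]] := paracompact_shrinking (S := fun x => (O x)°) pX.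
- by move=> x; exact: open_interior.
- by apply/seteqP; split => // x _; exists x => //; exact: nO.
pose U' j := if (j < i)%N then U j else V.
have cellU' c z : level i c -> cell U' c z -> cell U c z.
  by move=> lc; apply: level_cell lc _ _ => j ji; rewrite /U' ji.
have cellV c z y : c i = Some y -> cell U' c z -> O y z.
  by move=> ci zc; apply: interior_subset; apply: VO; have := zc _ _ ci; rewrite /U' ltnn.
have cell_center c z y : level i.+1 c -> c i = Some y -> cell U' c z ->
    cell U (del c i) y.
  move=> lc ci zc j w dj; have [_ Oy] := cellV _ _ _ ci zc.
  have ji : (j < i)%N.
    by apply: level_dom (level_del lc) _; rewrite /dom /= dj.
  apply: Oy => //; have := zc j w (del_subchain dj).
  by rewrite /U' ji.
exists V, (fun c => if c i is Some y then G y (del c i) else g c); split => //.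
  by move=> c lc; rewrite lc.
move=> c z lc zc; case ci: (c i) => [y|].
  have ldc := level_del lc; have ydc := cell_center _ _ _ lc ci zc.
  have [cG GF Gg GG] := GP y _ ldc ydc (chain_size_le i _ : (_ < i.+1)%N).
  split=> // [_ t|c' cc t tc'].
    by have [+ _] := cellV _ _ _ ci zc; apply.
  case c'i: (c' i) => [y'|].
    have := cc _ _ c'i; rewrite ci => -[<-].
    apply: GG; last exact: faceS (@dom_del c' i) _ tc'.
    apply: subchain_del; last by rewrite /del eqxx.
    by move=> j w /del_subchain /cc.
  have cd := subchain_del cc c'i.
  have [_ _ gS] := Ig _ _ ldc ydc.
  by rewrite (gS _ cd)// Gg//; apply: faceS tc'; exact: subchain_dom.
have lc' : level i c by rewrite -(del_id ci); exact: level_del.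
have [cg gF gS] := Ig _ _ lc' (cellU' _ _ lc' zc).
split => // [nc t|c' cc t tc'].
  by apply: (Fi_le (leq_addr _ _)); exact: gF.
by rewrite (subchain_level cc lc')//; exact: gS.
Qed.

Lemma coherent_ext i n U U' g : (forall j, (j < i)%N -> U j = U' j) ->
  coherent i n U g -> coherent i n U' g.
Proof.
move=> UU Ig c z lc zc; apply: Ig => //; apply: level_cell lc _ _ zc.
by move=> j /UU.
Qed.

Lemma coherent_sequence : exists (U : nat -> X -> set X)
    (g : nat -> chain -> T -> Y), [/\ forall i y, open (U i y),
    forall i, \bigcup_y U i y = setT, forall i, locally_finite_family (U i),
    forall i c, level i.+1 c -> g i.+1 c = g i c &
    forall i, exists n, coherent i.+1 n U (g i)].
Proof.
pose prevg (l : nat -> (X -> set X) * (chain -> T -> Y)) i :=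
  if i is i'.+1 then (l i').2 else fun _ _ => y0.
pose P i (l : nat -> (X -> set X) * (chain -> T -> Y)) :=
  [/\ forall y, open ((l i).1 y), \bigcup_y (l i).1 y = setT,
    locally_finite_family (l i).1, forall c, level i c -> (l i).2 c = prevg l i c &
    exists n, coherent i.+1 n (fun j => (l j).1) (l i).2].
have [||l lP] := @prefix_choice _ (fun _ => set0, fun _ _ => y0) P.
- move=> k l l' ll' [oU cU lfU gU [n Ig]]; split; rewrite -?ll'//.
    by move=> c lc; rewrite gU//; case: k ll' {oU cU lfU gU Ig lc} => //= k ->.
  exists n; apply: coherent_ext Ig => j jk.
  by rewrite ll'.
- move=> k l lP.
  have [n Ig] : exists n, coherent k n (fun j => (l j).1) (prevg l k).
    case: k lP => [_|k lP]; last by have [] := lP k (ltnSn k).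
    (* Only the empty chain has level 0. Neither continuity nor values in the filtration are asked
       of its map, so the constant [y0] starts the recursion. *)
    exists 0%N => c z lc _; have c0 : c = fun=> None by apply/funext => j; exact: lc.
    by split; rewrite c0 ?eqxx.
  have lfU j : (j < k)%N -> locally_finite_family (l j).1.
    by move=> /lP[].
  have [V [g' [oV cV lfV gg Ig']]] := coherent_step lfU Ig.
  exists (V, g'); split; rewrite ?ltnn//=.
    move=> c lc; rewrite gg//; case: (k) => //= k'.
    by rewrite ltnSn.
  exists (n + k.+1)%N; apply: coherent_ext Ig' => j jk.
  by case: ifP.
exists (fun i => (l i).1), (fun i => (l i).2); split.
- by move=> i; case: (lP i).
- by move=> i; case: (lP i).
- by move=> i; case: (lP i).
- by move=> i c lc; case: (lP i.+1) => _ _ _ ->.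
- by move=> i; case: (lP i).
Qed.

(** * From coherent families to a selection *)

Hypothesis X_C : C_space X.
Hypothesis lift : forall pi : nat -> X -> R, (forall n, continuous (pi n)) ->
  (forall n x, 0 <= pi n x <= 1) ->
  exists2 phi : X -> T, continuous phi & forall n x, p n (phi x) = pi n x.

(** At [z] the C-space property leaves at most one index per level; the map of this chain, applied
    to the lift of [z] to [T], gives [f z]. Near [z0] all chains are subchains of that of [z0], so
    by coherence [f] agrees there with a single continuous map. *)
Lemma filtered_selection (x0 : X) :
  exists2 f : X -> Y, continuous f & forall x, exists n, Fi n x (f x).
Proof.
have [U [g [oU cU lfU gS Ig]]] := coherent_sequence.
have [i|sigma [[oS cS] tS rS]] := X_C (omega := fun i => range (U i)).
  split; first by move=> _ [y _ <-].
  apply/seteqP; split => // x _.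
  by have [y _ Uy] : (\bigcup_y U i y) x; [rewrite cU|exists (U i y) => //; exists y].
pose S i := \bigcup_(V in sigma i) V.
have oSi i V : sigma i V -> open V by move=> iV; apply: oS; exists i.
have cSi : \bigcup_i S i = setT.
  apply/seteqP; split => // x _.
  have [V [i _ iV] Vx] : (\bigcup_(V in \bigcup_i sigma i) V) x by rewrite cS.
  by exists i => //; exists V.
(* Two shrinkings make room for [pi i], which is 1 on [D i] and 0 off [Q i]. As the [D i] cover [X],
   some coordinate of every point is 1. *)
have [|Q [oQ cQ QS lfQ]] := paracompact_shrinking pX _ cSi.
  by move=> i; apply: bigcup_open => V; exact: oSi.
have [D [oD cD DQ lfD]] := paracompact_shrinking pX oQ cQ.
have /choice[pi piP] i : exists pi : X -> R, [/\ continuous pi,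
    forall x, 0 <= pi x <= 1, forall x, ~ Q i x -> pi x = 0 &
    forall x, D i x -> pi x = 1].
  have /(@normal_separatorP R) := paracompact_normal R pX.
  move=> /(_ (~` Q i) (closure (D i)))[].
  - exact: open_closedC.
  - exact: closed_closure.
  - by rewrite -subset0 => x [nQ /DQ].
  move=> uT [E sep].
  have {sep}/(@uniform_separatorP _ R)[h [ch h01 h0 h1]] :
    uniform_separator (~` Q i) (closure (D i)) by exists uT, E.
  exists h; split => //.
  - by move=> x; have := h01 (h x); rewrite /= in_itv /=; apply; exists x.
  - by move=> x nQ; apply: h0; exists x.
  - by move=> x /subset_closure Dx; apply: h1; exists x.
have [||phi cphi phiE] := @lift pi;
  [by move=> n; case: (piP n)|by move=> n; case: (piP n)|].
have /choice[w wP] (iV : nat * set X) :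
    exists y, sigma iV.1 iV.2 -> iV.2 `<=` U iV.1 y.
  have [/rS[_ [y _ <-] Vy]|nV] := pselect (sigma iV.1 iV.2); first by exists y.
  by exists x0.
have /choice[V VP] (iz : nat * X) :
    exists V, S iz.1 iz.2 -> sigma iz.1 V /\ V iz.2.
  have [[V iV Vz]|nS] := pselect (S iz.1 iz.2); first by exists V.
  by exists set0.
(* Closed and locally finite sets: no new level enters the chain near [z0]. *)
pose C i := closure (Q i).
have CS i z : C i z -> S i z by move=> /QS.
pose cz z : chain := fun i => if `[< C i z >] then Some (w (i, V (i, z))) else None.
have czE z i : cz z i -> C i z by rewrite /cz; case: asboolP.
have lfC : locally_finite_family C by exact: closure_locally_finite.
have /choice[N lvN] z : exists n, level n.+1 (cz z).
  have [W nW fW] := lfC z.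
  pose F := [set i | C i `&` W !=set0].
  exists (\max_(i <- finmap.enum_fset (fset_set F)) i)%N => j.
  rewrite /cz; case: asboolP => // Cj; rewrite ltnNge => /negP[].
  apply: (@leq_bigmax_seq _ _ xpredT (fun i => i)) => //.
  rewrite in_fset_set//; apply: mem_set.
  by exists z; split => //; exact: nbhs_singleton.
have cellz z : cell U (cz z) z.
  move=> j y; rewrite /cz; case: asboolP => // Cj [<-].
  have [sV Vz] := VP (j, z) (CS _ _ Cj).
  by apply: subset_closure; exact: (wP (j, V (j, z)) sV).
have facez z : face (dom (cz z)) (phi z).
  split.
    move=> j; rewrite phiE /dom /= /cz; case: asboolP => // nC.
    have [_ _ -> //] := piP j; rewrite ?eqxx// => Qz.
    by apply: nC; exact: subset_closure.
  have [j _ Dj] : (\bigcup_i D i) z by rewrite cD.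
  by exists j; rewrite phiE; have [_ _ _ ->] := piP j.
have nez z : cz z != fun=> None.
  have [+ [j pj]] := facez z; move=> /(_ j); rewrite pj oner_neq0 => /(_ isT).
  by apply: contraTneq => ->.
have gE z d : g (N z + d)%N (cz z) = g (N z) (cz z).
  elim: d => [|d IH]; first by rewrite addn0.
  rewrite addnS gS// => j Nj; apply: lvN.
  by apply: leq_trans Nj; rewrite ltnS leq_addr.
(* Near [z0], the point [z] lies in the member of [sigma i] chosen at [z0]; disjointness of
   [sigma i] forces the same member, hence the same index, at [z]. *)
have near_sub z0 : \forall z \near z0, subchain (cz z) (cz z0).
  have clC i : closed (C i) by exact: closed_closure.
  have nV : \forall z \near z0, forall i, dom (cz z0) i -> V (i, z0) z.
    apply: (filterS _ (@filter_finite_bigcap _ _ (nbhs z0) (dom (cz z0))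
      (fun i => V (i, z0)) _ (finite_dom (lvN z0)) _)).
      by move=> z Hz i ci; exact: Hz.
    move=> i /czE/CS/(VP (i, z0))[sV Vz]; apply: open_nbhs_nbhs; split => //.
    exact: oSi sV.
  near=> z => i y.
  have Cz : forall i, C i z -> C i z0 by near: z; exact: locally_finite_nbhs.
  have Vz : forall i, dom (cz z0) i -> V (i, z0) z by near: z.
  have := Vz i; rewrite /dom /= /cz.
  case: (asboolP (C i z)) => // Ciz + [<-].
  rewrite asboolT//=; last exact: Cz.
  move=> /(_ isT) Vz0; congr (Some (w (i, _))).
  have [sV0 V0] := VP (i, z0) (CS _ _ (Cz _ Ciz)).
  have [sV1 V1] := VP (i, z) (CS _ _ Ciz).
  by apply: (tS i) => //; exists z.
exists (fun z => g (N z) (cz z) (phi z)); last first.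
  move=> z; have [n In] := Ig (N z); exists n.
  by have [_ + _] := In _ _ (lvN z) (cellz z); apply; exact: nez.
move=> z0; have [n In] := Ig (N z0).
have [cg _ _] := In _ _ (lvN z0) (cellz z0).
have : (fun z => g (N z0) (cz z0) (phi z)) @ z0 --> g (N z0) (cz z0) (phi z0).
  by apply: continuous_comp; [exact: cphi|exact: cg (nez z0) _].
apply: cvg_trans; apply: near_eq_cvg; near=> z.
have zz : subchain (cz z) (cz z0) by near: z; exact: near_sub.
(* The two maps come from different stages; both are unchanged at the common stage [N z + N z0],
   where coherence compares them. *)
have [m Im] := Ig (N z + N z0)%N.
have lv : level (N z + N z0).+1 (cz z0).
  by move=> j Nj; apply: lvN; apply: leq_trans Nj; rewrite ltnS leq_addl.
have [_ _ gS'] := Im _ _ lv (cellz z0).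
by have := gS' _ zz _ (facez z); rewrite gE addnC gE => ->.
Unshelve. all: by end_near.
Qed.

End selection.

(** * Universal compacta *)

(** A copy of [U] that carries its own metric: the possibly infinite distance of [P], truncated at
    1. The Hausdorff property is a parameter because it makes this distance separate points. *)
Definition metrized (R : realType) (P : pseudoMetricType R)
  (hP : hausdorff_space P) (U : set P) : Type := U.

Section metrized.
Variables (R : realType) (P : pseudoMetricType R) (hP : hausdorff_space P).
Variable U : set P.
Local Open Scope ereal_scope.

Let d (x y : P) : \bar R := mine (edist (x, y)) 1.

Let d_fin x y : d x y \is a fin_num.
Proof.
rewrite ge0_fin_numE; first by rewrite /d gt_min ltry orbT.
by rewrite /d le_min edist_ge0 lee01.
Qed.

Let v (x : metrized hP U) : P := set_val (x : U).

Let mdist (x y : metrized hP U) : R := fine (d (v x) (v y)).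

Let mdistxx x : mdist x x = 0%R.
Proof. by rewrite /mdist /d edist_refl min_l. Qed.

Let mdist_positivity x y : mdist x y = 0%R -> x = y.
Proof.
move=> m0; apply: val_inj.
have d0 : d (v x) (v y) = 0 by rewrite -[d _ _]fineK// -/(mdist x y) m0.
apply: hP; rewrite -closeEnbhs; apply/edist_closeP.
move: d0; rewrite /d; have [//|_ /eqP] := leP (edist (v x, v y)) 1.
by rewrite onee_eq0.
Qed.

Let mdist_sym x y : mdist x y = mdist y x.
Proof. by rewrite /mdist /d edist_sym. Qed.

Let mdist_triangle y x z : (mdist x z <= mdist x y + mdist y z)%R.
Proof.
rewrite -lee_fin EFinD /mdist !fineK// /d.
have xy0 := edist_ge0 (v x, v y); have yz0 := edist_ge0 (v y, v z).
have txz := edist_triangle (v x) (v y) (v z).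
have [_|_] := leP (edist (v x, v y)) 1; last first.
  apply: (le_trans (y := 1)); first by rewrite ge_min lexx orbT.
  by rewrite leeDl// le_min yz0 lee01.
have [_|_] := leP (edist (v y, v z)) 1; last first.
  by apply: (le_trans (y := 1)); [rewrite ge_min lexx orbT|rewrite leeDr].
by rewrite ge_min txz.
Qed.

HB.instance Definition _ := Choice.on (metrized hP U).
HB.instance Definition _ := isMetric.Build R (metrized hP U)
  mdistxx mdist_positivity mdist_sym mdist_triangle.

Lemma metrizable : exists (T : metricType R) (val : T -> P),
  [/\ continuous val, injective val, range val = U &
    forall t (B : set T), nbhs t B ->
      exists2 C : set P, nbhs (val t) C & val @^-1` C `<=` B].
Proof.
exists (metrized hP U), v; split.
- move=> x A /(@nbhs_ballP R P)[e /= e0 eA].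
  (* Truncation does not affect distances below 1. *)
  apply/(@nbhs_ballP R (metrized hP U)); exists (Num.min e 1%R) => /=.
    by rewrite lt_min e0 ltr01.
  move=> y; rewrite ballEmdist /= -lte_fin [X in X < _]fineK// /d => xy.
  apply: eA; have : @edist R P (v x, v y) < (Num.min e 1%R)%:E.
    move: xy; rewrite gt_min => /orP[//|].
    by rewrite lte_fin lt_min ltxx andbF.
  move=> /edist_lt_ball; apply: le_ball.
  by rewrite ge_min lexx.
- exact: val_inj.
- apply/seteqP; split => [_ [x _ <-]|x Ux]; first exact: (set_mem (valP x)).
  by exists (SigSub (mem_set Ux) : U).
- move=> x A /(@nbhs_ballP R (metrized hP U))[e /= e0 eA].
  have e20 : (0 < e / 2)%R by rewrite divr_gt0.
  exists (ball (v x) (e / 2)%R); first exact: nbhsx_ballx.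
  move=> y /= xy; apply: eA.
  rewrite ballEmdist /= -lte_fin [_%:E]fineK// /d gt_min; apply/orP; left.
  apply: le_lt_trans (edist_fin (xy := (v x, v y)) e20 xy) _.
  by rewrite lte_fin gtr_pMr// invf_lt1// ltr1n.
Qed.
End metrized.

Lemma cvg_rV (R : topologicalType) (n : nat) (T : Type) (F : set_system T)
    (f : T -> 'rV[R]_n) (v : 'rV[R]_n) : Filter F ->
  (forall j, (fun x => f x 0 j) @ F --> v 0 j) -> f @ F --> v.
Proof.
move=> FF fv A [P vP PA]; rewrite nbhs_simpl /=.
apply: filterS (_ : F (fun x => forall j, P 0 j (f x 0 j))).
  by move=> x Px; apply: PA => i j; rewrite ord1.
by apply: filter_forall => j; apply: fv; exact: vP.
Qed.

Lemma row_continuous (U X : topologicalType) (n : nat) (f : 'I_n -> X -> U) :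
  (forall j, continuous (f j)) -> continuous (fun x => \row_j f j x).
Proof.
move=> cf x; apply: cvg_rV => j; rewrite mxE.
by under eq_fun do rewrite mxE; exact: cf.
Qed.

Lemma cvg_prod_topology (I : Type) (K : I -> topologicalType) (T : Type)
    (F : set_system T) (f : T -> prod_topology K) (t : prod_topology K) :
  Filter F -> (forall i, (fun x => f x i) @ F --> t i) -> f @ F --> t.
Proof.
move=> FF ft; apply/cvg_sup => i A [B [[Q oQ <-] Qt] BA].
have : nbhs (t i) Q by apply: open_nbhs_nbhs.
move=> /(ft i) fQ; rewrite nbhs_simpl /=.
have H : F [set x | Q (f x i)] by exact: fQ.
by apply: (@filterS _ F _ _ _ _ H) => x Qx; exact: BA.
Qed.

Lemma prod_topology_continuous (I : Type) (K : I -> topologicalType)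
    (X : topologicalType) (f : X -> prod_topology K) :
  (forall i, continuous (fun x => f x i)) -> continuous f.
Proof. by move=> cf x; apply: cvg_prod_topology => i; exact: cf. Qed.

Lemma pair_continuous (X Y Z : topologicalType) (f : X -> Y) (g : X -> Z) :
  continuous f -> continuous g -> continuous (fun x => (f x, g x)).
Proof. by move=> cf cg x; apply: cvg_pair; [exact: cf|exact: cg]. Qed.

Lemma tietze_rV (R : realType) (X : topologicalType) (n : nat) (A : set X)
    (f : X -> 'rV[R]_n) : normal_space X -> closed A ->
  {within A, continuous f} ->
  (exists M, forall x, A x -> forall j, `|f x 0 j| <= M) ->
  exists2 g : X -> 'rV[R]_n, continuous g & forall x, A x -> g x = f x.
Proof.
move=> nX clA cf [M fM].
have /choice[g gP] j : exists g : X -> R, continuous g /\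
    forall x, A x -> g x = f x 0 j.
  have [| | |g [gf cg _]] :=
      @continuous_bounded_extension X R nX A clA (fun x => f x 0 j) (`|M| + 1).
  - by rewrite ltr_wpDl.
  - move=> x; apply: (@continuous_comp (subspace A) _ _ f (fun v : 'rV[R]_n => v 0 j)).
      exact: cf.
    exact: coord_continuous.
  - move=> x Ax; rewrite (le_trans (fM x Ax j))// (le_trans (ler_norm _))//.
    by rewrite lerDl.
  by exists g; split => // x /mem_set/gf.
exists (fun x => \row_j g j x).
  by apply: row_continuous => j; have [] := gP j.
move=> x Ax; apply/rowP => j; rewrite mxE.
by have [_ ->] := gP j.
Qed.

Section distance_to_set.
Variables (R : realType) (V : normedModType R) (K : set V).

Definition dist_set (z : V) : R := inf [set `|z - a| | a in K].

Let lb z : has_lbound [set `|z - a| | a in K].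
Proof. by exists 0 => _ [a _ <-]. Qed.

Lemma dist_set_le z a : K a -> dist_set z <= `|z - a|.
Proof. by move=> Ka; apply: ge_inf => //; exists a. Qed.

Lemma dist_set0 a : K a -> dist_set a = 0.
Proof.
move=> Ka; apply/eqP; rewrite eq_le.
have := dist_set_le a Ka; rewrite subrr normr0 => -> /=.
by apply: lb_le_inf; [exists `|a - a|, a|move=> _ [b _ <-]].
Qed.

Hypothesis K0 : K !=set0.

Lemma dist_set_ge0 z : 0 <= dist_set z.
Proof.
by case: K0 => a Ka; apply: lb_le_inf; [exists `|z - a|, a|move=> _ [b _ <-]].
Qed.

Lemma dist_set_lt z e : dist_set z < e -> exists2 a, K a & `|z - a| < e.
Proof.
case: K0 => b Kb /inf_lt; have S0 : [set `|z - a| | a in K] !=set0.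
  by exists `|z - b|, b.
by move=> /(_ S0)[_ [a Ka <-]]; exists a.
Qed.

Lemma dist_set_lipschitz z y : dist_set z <= dist_set y + `|z - y|.
Proof.
apply/ler_addgt0Pr => e e0.
have [|a Ka ya] := @dist_set_lt y (dist_set y + e); first by rewrite ltrDl.
apply: le_trans (dist_set_le z Ka) _.
rewrite (_ : z - a = (z - y) + (y - a)); last by rewrite addrA subrK.
apply: le_trans (ler_normD _ _) _.
by apply: le_trans (lerD (lexx _) (ltW ya)) _; rewrite addrCA addrA.
Qed.

Lemma dist_set_continuous : continuous dist_set.
Proof.
move=> z; apply/cvgrPdist_le => e e0; near=> y.
have yz : `|z - y| <= e.
  by near: y; apply: cvgr_dist_le.
rewrite ler_norml; apply/andP; split.
  rewrite lerNl opprB lerBlDl; apply: le_trans (dist_set_lipschitz y z) _.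
  by rewrite lerD2l distrC.
rewrite lerBlDl; apply: le_trans (dist_set_lipschitz z y) _.
by rewrite lerD2l.
Unshelve. all: by end_near.
Qed.

Lemma dist_set_eq0 z : closed K -> dist_set z = 0 -> K z.
Proof.
move=> clK z0; apply: clK => A /nbhs_ballP[e /= e0 eA].
have [|a Ka za] := @dist_set_lt z e; first by rewrite z0.
by exists a; split => //; apply: eA; rewrite -ball_normE.
Qed.

End distance_to_set.

(** [r] is total, but nothing is asked of it away from [K]: it is a retraction of some neighbourhood
    of [K]. *)
Definition nbhd_retraction (V : topologicalType) (K : set V) (r : V -> V) :=
  (forall x, K x -> r x = x) /\
  (forall x, K x -> \forall z \near x, {for z, continuous r} /\ K (r z)).

(** Compactness makes the good neighbourhoods of the points of [K] uniform; half of each local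
    radius leaves room for moving the centre. *)
Lemma nbhd_retraction_dist (R : realType) (V : normedModType R) (K : set V)
    (r : V -> V) : compact K -> K !=set0 -> nbhd_retraction K r ->
  exists2 e : R, 0 < e &
    forall z, dist_set K z < e -> {for z, continuous r} /\ K (r z).
Proof.
move=> /compact_near_coveringP cK K0 [_ rK].
pose P (e : R) (x : V) := forall z, `|x - z| < e ->
  {for z, continuous r} /\ K (r z).
have : \forall e \near 0^'+, K `<=` P e.
  apply: cK => x /rK /nbhs_ballP[d /= d0 dP].
  exists (ball x (d / 2), [set e | e < d / 2]) => /=.
    split; first by apply: nbhsx_ballx; rewrite divr_gt0.
    by apply: nbhs_right_lt; rewrite divr_gt0.
  move=> [y e] /= [xy ed] z yz; apply: dP.
  apply: ball_split xy _; rewrite -ball_normE /=.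
  exact: lt_trans ed.
move=> H; have [e [e0 eK]] : exists e : R, 0 < e /\ K `<=` P e.
  near (0 : R)^'+ => e; exists e; split; near: e => //.
  exact: nbhs_right_gt.
exists e => // z /(dist_set_lt K0)[a Ka za].
by apply: (eK a Ka); rewrite distrC.
Unshelve. all: by end_near.
Qed.

Lemma continuous_at_max (R : realType) (T : topologicalType) (f g : T -> R) x :
  {for x, continuous f} -> {for x, continuous g} ->
  {for x, continuous (fun z => Num.max (f z) (g z))}.
Proof.
move=> cf cg.
suff : {for x, continuous ((f : T -> R^o) \max (g : T -> R^o))} by [].
exact: continuous_max.
Qed.

Section clamp.
Variable R : realType.
Implicit Type x : R.

Definition clamp x : R := Num.max 0 (Num.min 1 x).

Lemma clamp_continuous : continuous clamp.
Proof.
move=> x.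
suff : {for x, continuous ((fun=> 0 : R^o) \max ((fun=> 1 : R^o) \min (id : R -> R^o)))}.
  by [].
apply: continuous_max; first exact: cvg_cst.
by apply: continuous_min; [exact: cvg_cst|exact: cvg_id].
Qed.

Lemma clamp_ge0 x : 0 <= clamp x.
Proof. by rewrite le_max lexx. Qed.

Lemma clamp_le1 x : clamp x <= 1.
Proof. by rewrite ge_max ler01 ge_min lexx. Qed.

Lemma clamp0 x : x <= 0 -> clamp x = 0.
Proof. by move=> x0; rewrite /clamp max_l// ge_min x0 orbT. Qed.

Lemma clamp1 x : 1 <= x -> clamp x = 1.
Proof. by move=> x1; rewrite /clamp min_l// max_r. Qed.

End clamp.

Lemma injective_unbounded (f : nat -> nat) (N : nat) : injective f ->
  exists r, (N <= f r)%N.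
Proof.
move=> fI; apply: contrapT => nf.
have fN r : (f r < N)%N by rewrite ltnNge; apply/negP => Nf; apply: nf; exists r.
have gI : injective (fun i : 'I_N.+1 => Ordinal (fN i)).
  by move=> i j [] /fI ij; exact: val_inj.
by have := leq_card _ gI; rewrite !card_ord ltnn.
Qed.

Lemma rV_int_approx (R : realType) (m : nat) (v : 'rV[R]_m) (e : R) : 0 < e ->
  exists u : 'rV[int]_m, `|v - e *: map_mx intr u| <= e.
Proof.
move=> e0; exists (\row_j Num.floor (v 0 j / e)).
rewrite [leLHS]mx_normrE; apply/bigmax_leP; split; first exact: ltW.
move=> [i j] _ /=; rewrite !mxE ord1.
have := floor_itv (v 0 j / e); move: (Num.floor _) => k /andP[k1 k2].
rewrite ger0_norm; last by rewrite subr_ge0 -ler_pdivlMl// mulrC.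
move: k2; rewrite ltr_pdivrMr// intrD mulrDl mul1r mulrC => k2.
by rewrite lerBlDl ltW.
Qed.

Lemma near_eventually_ex (P : nat -> Prop) : (\forall n \near \oo, P n) ->
  exists n, P n.
Proof. by case=> N _ NP; exists N; apply: NP => /=. Qed.

(* Countably many patterns record the approximate values of a function on the
   members of finite covers of [C]; one function is kept for each pattern. *)
Lemma dense_sequence (R : realType) (m : nat) (W : pseudoMetricType R)
    (C : set W) : compact C ->
  exists c : nat -> W -> 'rV[R]_m, (forall n, continuous (c n)) /\
    forall (h : W -> 'rV[R]_m) (e : R), continuous h -> 0 < e ->
      exists2 q : W -> 'rV[R]_m, (forall t, C t -> `|h t - q t| < e) &
        forall N, exists2 n, (N <= n)%N & c n = q.
Proof.
move=> cC.
have /choice[s sP] (j : nat) : exists s : seq W, (forall x, x \in s -> C x) /\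
    forall t, C t -> exists2 x, x \in s & ball x j.+1%:R^-1 t.
  have j0 : 0 < j.+1%:R^-1 :> R by rewrite invr_gt0.
  (* Finite subsets of [C] directed by inclusion: the near-covering form of compactness then yields
     a finite net. *)
  pose F : set_system (seq W) := filter_from (fun s : seq W => {subset s <= C})
    (fun s => [set s' : seq W | {subset s <= s'} /\ {subset s' <= C}]).
  have FF : Filter F.
    apply: filter_from_filter; first by exists [::].
    move=> s1 s2 s1C s2C; exists (s1 ++ s2).
      by move=> x; rewrite mem_cat => /orP[/s1C|/s2C].
    by move=> s' [ss s'C]; split; split => // x xs; apply: ss; rewrite mem_cat xs ?orbT.
  move: (cC) => /compact_near_coveringP/(_ _ F
    (fun s t => exists2 x, x \in s & ball x j.+1%:R^-1 t) FF)[].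
    move=> x Cx; exists (ball x j.+1%:R^-1,
        [set s' : seq W | {subset [:: x] <= s'} /\ {subset s' <= C}]).
      split; first exact: nbhsx_ballx.
      by exists [:: x] => // y; rewrite inE => /eqP ->; apply/mem_set.
    move=> [t s'] /= [xt [xs _]]; exists x => //.
    by apply: xs; rewrite mem_head.
  move=> s sC sP; exists s; split; first by move=> x /sC /set_mem.
  by move=> t Ct; apply: (sP s) => //; split.
(* A net, the mesh [1/(i+1)] of a grid of values, and a list of grid points for the net points. *)
pose pattern : Type := (nat * nat * seq 'rV[int]_m)%type.
pose fits (pt : pattern) (h : W -> 'rV[R]_m) :=
  forall k, (k < size (s pt.1.1))%N -> forall t x, C t -> x = nth t (s pt.1.1) k ->
    ball x pt.1.1.+1%:R^-1 t ->
    `|h t - pt.1.2.+1%:R^-1 *: map_mx intr (nth 0 pt.2 k)| <= 2 * pt.1.2.+1%:R^-1.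
have /choice[q qP] (pt : pattern) : exists q : W -> 'rV[R]_m, continuous q /\
    ((exists2 h, continuous h & fits pt h) -> fits pt q).
  have [[h ch hP]|nh] := pselect (exists2 h, continuous h & fits pt h).
    by exists h.
  by exists (fun=> 0); split; [move=> x; exact: cvg_cst|].
(* Pairing a pattern with an arbitrary number makes it occur infinitely often. *)
exists (fun n =>
  if @unpickle (pattern * nat)%type n is Some (pt, _) then q pt else fun=> 0).
split.
  move=> n; case: unpickle => [[pt _]|]; first by have [] := qP pt.
  by move=> x; exact: cvg_cst.
move=> h e ch e0.
(* [h] and [q pt] both stay within [2/(i+1)] of the recorded value, hence the factor 4. *)
have [i ie] : exists i : nat, 4 * i.+1%:R^-1 < e.
  have e40 : 0 < e / 4 by rewrite divr_gt0.
  have [i _ iP] := near_infty_natSinv_lt (PosNum e40).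
  by exists i; have := iP i (leqnn i); rewrite /= ltr_pdivlMr// mulrC.
have i0 : 0 < i.+1%:R^-1 :> R by rewrite invr_gt0.
have [j jP] : exists j : nat, C `<=` [set x | forall t, ball x j.+1%:R^-1 t ->
    `|h x - h t| < i.+1%:R^-1].
  apply: near_eventually_ex.
  move: (cC) => /compact_near_coveringP; apply => x Cx.
  have := ch x; move=> /cvgrPdist_lt/(_ (i.+1%:R^-1 / 2)).
  rewrite divr_gt0// => /(_ isT) /nbhs_ballP[d /= d0 dP].
  have d20 : 0 < d / 2 by rewrite divr_gt0.
  exists (ball x (d / 2), [set k : nat | k.+1%:R^-1 < d / 2]) => /=.
    split; first exact: nbhsx_ballx.
    exact: near_infty_natSinv_lt (PosNum d20).
  move=> [y k] /= [xy kd] t yt.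
  have xt : ball x d t by apply: ball_split xy _; apply: le_ball yt; exact: ltW.
  have xy' : ball x d y by apply: le_ball xy; rewrite ler_pdivrMr// ler_pMr// ler1n.
  rewrite (_ : h y - h t = (h x - h t) - (h x - h y)); last first.
    by rewrite opprB [RHS]addrC addrA subrK.
  rewrite [X in _ < X](splitr i.+1%:R^-1).
  by apply: le_lt_trans (ler_normB _ _) _; apply: ltrD; exact: dP.
have /choice[u uP] (x : W) := rV_int_approx (h x) i0.
pose pt : pattern := (j, i, map u (s j)).
have hfit : fits pt h.
  move=> k ks t x Ct xE xt; rewrite /= in ks xt *.
  have xs : x \in s j by rewrite xE mem_nth.
  rewrite (nth_map x)// (set_nth_default t)// -xE.
  rewrite (_ : h t - _ =
      (h t - h x) + (h x - i.+1%:R^-1 *: map_mx intr (u x))); last first.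
    by rewrite addrA subrK.
  rewrite mulrDl mul1r; apply: le_trans (ler_normD _ _) _; apply: lerD => //.
  by rewrite distrC ltW//; apply: jP => //; exact: (sP j).1.
have qfit : fits pt (q pt) by apply: (qP pt).2; exists h.
exists (q pt).
  move=> t Ct; have [x xs xt] := (sP j).2 t Ct.
  have xE : x = nth t (s j) (index x (s j)) by rewrite nth_index.
  have ks : (index x (s j) < size (s j))%N by rewrite index_mem.
  have h1 := hfit _ ks t x Ct xE xt; have h2 := qfit _ ks t x Ct xE xt.
  move: h1 h2; set z := _ *: _ => h1 h2; apply: le_lt_trans ie.
  rewrite (_ : h t - q pt t = (h t - z) - (q pt t - z)); last first.
    by rewrite opprB addrA subrK.
  apply: le_trans (ler_normB _ _) _; apply: le_trans (lerD h1 h2) _.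
  by rewrite -mulrDl -natrD.
move=> N; have [|r rN] := @injective_unbounded (fun r => pickle (pt, r)) N.
  by move=> r r' /(pcan_inj pickleK_inv)[].
by exists (pickle (pt, r)) => //; rewrite pickleK.
Qed.

Definition extends_into (X V : topologicalType) (K : set V) : Prop :=
  forall (A : set X) (f : X -> V), closed A -> {within A, continuous f} ->
    (forall x, A x -> K (f x)) ->
  exists g : X -> V, [/\ continuous g, forall x, K (g x) &
    forall x, A x -> g x = f x].

(** * A compactum in the countable power of [0,1] x K, with extension and lifting properties *)

Section universal_compactum.
Variables (R : realType) (m : nat).
Notation V := 'rV[R]_m.
Variables (K : set V) (a0 : V) (r : V -> V) (e : R).
Hypothesis K_compact : compact K.
Hypothesis Ka0 : K a0.
Hypothesis rK : forall x, K x -> r x = x.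
Hypothesis e_gt0 : 0 < e.
Hypothesis eP : forall z, dist_set K z < e -> {for z, continuous r} /\ K (r z).

Let K0 : K !=set0. Proof. by exists a0. Qed.

Let W := prod_topology (fun _ : nat => (R * V)%type).

Definition hilbert_box : set W :=
  [set t | forall n, 0 <= (t n).1 <= 1 /\ K (t n).2].

Let coord_cont n : continuous (fun t : W => t n).
Proof. exact: (@proj_continuous nat (fun _ => (R * V)%type) n). Qed.

Let snd_cont n : continuous (fun t : W => (t n).2).
Proof.
move=> t; apply: (@continuous_comp _ _ _ (fun t : W => t n) snd).
  exact: coord_cont.
exact: cvg_snd.
Qed.

Lemma hilbert_box_compact : compact hilbert_box.
Proof.
have := @tychonoff nat (fun _ => (R * V)%type) (fun _ => `[0, 1]%classic `*` K).
move=> /(_ (fun _ => compact_setX (@segment_compact _ _ _) K_compact)).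
by congr compact.
Qed.

Lemma box_hausdorff : hausdorff_space W.
Proof.
apply: (@hausdorff_product nat (fun _ => (R * V)%type)) => _.
exact: norm_hausdorff.
Qed.

Let W_normal : normal_space W. Proof. exact: pseudometric_normal. Qed.

(** A function of [trunc k t] depends only on the first [k] coordinates, which allows the
    coordinates to be chosen successively. *)
Definition trunc (k : nat) (t : W) : W := fun n => if (n < k)%N then t n else (0, a0).

Lemma trunc_continuous k : continuous (trunc k).
Proof.
apply: prod_topology_continuous => n; rewrite /trunc.
by case: (n < k)%N; [exact: coord_cont|exact: cst_continuous].
Qed.

(** [trunc k t] tends to [t] jointly in [k] and the point; compactness of the box makes the
    approximation uniform. *)
Lemma trunc_approx (h : W -> V) (d : R) : continuous h -> 0 < d ->
  exists N, forall k, (N <= k)%N -> forall t, hilbert_box t ->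
    `|h t - h (trunc k t)| < d.
Proof.
move=> ch d0.
have /compact_near_coveringP/(_ nat \oo
  (fun k t => `|h t - h (trunc k t)| < d))[] := hilbert_box_compact.
  move=> t _; pose G : set_system (W * nat) := filter_prod (nbhs t) \oo.
  have cG : (fun x : W * nat => trunc x.2 x.1) @ G --> t.
    apply: cvg_prod_topology => n.
    have : (fun x : W * nat => x.1 n) @ G --> t n.
      apply: (@cvg_comp _ _ _ (fun x : W * nat => x.1) (fun s : W => s n) G (nbhs t)).
        exact: cvg_fst.
      exact: coord_cont.
    apply: cvg_trans; apply: near_eq_cvg.
    exists (setT, [set k | (n < k)%N]).
      by split; [exact: filterT|exact: nbhs_infty_gt].
    by move=> [s k] [_ /= nk]; rewrite /trunc nk.
  have h1 : (h \o (fun x : W * nat => trunc x.2 x.1)) @ G --> h t.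
    exact: cvg_comp cG (ch t).
  have h2 : (fun x : W * nat => h x.1) @ G --> h t.
    apply: (@cvg_comp _ _ _ (fun x : W * nat => x.1) h G (nbhs t)).
      exact: cvg_fst.
    exact: ch.
  have h0 : (fun x : W * nat => h x.1 - h (trunc x.2 x.1)) @ G --> (0 : V).
    by rewrite -(subrr (h t)); exact: cvgB h2 h1.
  by move/cvgr0Pnorm_lt : h0; exact.
move=> N _ NP; exists N => k Nk t Wt; exact: (NP k Nk t Wt).
Qed.

Variable c : nat -> W -> V.
Hypothesis c_cont : forall n, continuous (c n).
Hypothesis c_dense : forall (h : W -> V) (d : R), continuous h -> 0 < d ->
  exists2 q : W -> V, (forall t, hilbert_box t -> `|h t - q t| < d) &
    forall N, exists2 n, (N <= n)%N & c n = q.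

Let c' k t := c k (trunc k t).
(** The margin keeps [r] continuous on the closed set at distance at most [e1] from [K], and under
    the perturbation in [universal_extends]. *)
Let e1 := e / 2.
Let e1_gt0 : 0 < e1. Proof. by rewrite divr_gt0. Qed.
Let e1_lt : e1 < e. Proof. by rewrite gtr_pMr// invf_lt1// ltr1n. Qed.

Let c'_cont k : continuous (c' k).
Proof.
by move=> t; apply: continuous_comp; [exact: trunc_continuous|exact: c_cont].
Qed.

Let d_cont k : continuous (fun t => dist_set K (c' k t)).
Proof.
move=> t; apply: (@continuous_comp _ _ _ (c' k) (dist_set K)).
  exact: c'_cont.
exact: dist_set_continuous.
Qed.

(** Where [c k], read on the first [k] coordinates, is close to [K], its retraction must be the
    [K]-coordinate of index [k]. A map to be extended is close to some [c k], so a coordinate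
    provides its extension. *)
Definition universal_set : set W := hilbert_box `&`
  [set t | forall k, dist_set K (c' k t) < e1 -> (t k).2 = r (c' k t)].

(** The premise of each condition is open and [r] is continuous there, so violating the condition is
    open. *)
Lemma universal_set_compact : compact universal_set.
Proof.
apply: compact_closedI; first exact: hilbert_box_compact.
have -> : [set t | forall k, dist_set K (c' k t) < e1 -> (t k).2 = r (c' k t)] =
    \bigcap_k [set t | dist_set K (c' k t) < e1 -> (t k).2 = r (c' k t)].
  by apply/seteqP; split => t Ht k; [move=> _|]; exact: Ht.
apply: closed_bigI => k _; rewrite -openC openE => t /= /not_implyP[dt tr].
have nr : `|(t k).2 - r (c' k t)| > 0 by rewrite normr_gt0 subr_eq0; apply/eqP.
have [rc _] := eP (lt_trans dt e1_lt).
have cr : (fun s => (s k).2 - r (c' k s)) @ t --> (t k).2 - r (c' k t).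
  apply: (@cvgB _ _ _ (nbhs t) _ (fun s : W => (s k).2)); first exact: snd_cont.
  by apply: continuous_comp; [exact: c'_cont|exact: rc].
near=> s => /(_ _)H.
have : (s k).2 = r (c' k s).
  by apply: H; near: s; exact: (cvgr_lt _ (d_cont (k := k) (x := t)) _ dt).
apply/eqP; rewrite -subr_eq0 -normr_gt0; near: s.
by apply: (cvgr_gt _ (cvg_norm cr) _ nr).
Unshelve. all: by end_near.
Qed.

(** The [K]-coordinates are chosen one after another: each is prescribed on a closed set, and
    [extends_into] supplies the rest. *)
Lemma universal_lift (X : topologicalType) (pi : nat -> X -> R) :
  extends_into X K -> (forall n, continuous (pi n)) ->
  (forall n x, 0 <= pi n x <= 1) ->
  exists phi : X -> W, [/\ continuous phi, forall x, universal_set (phi x) &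
    forall n x, (phi x n).1 = pi n x].
Proof.
move=> XK cpi pi01.
pose tr k (l : nat -> X -> V) (x : X) : W :=
  fun n => if (n < k)%N then (pi n x, l n x) else (0, a0).
pose P k (l : nat -> X -> V) := [/\ continuous (l k), forall x, K (l k x) &
  forall x, dist_set K (c k (tr k l x)) < e1 -> l k x = r (c k (tr k l x))].
have [k l l' ll' [cl lK lr]|k l lP|l lP] := @prefix_choice _ (fun=> a0) P.
- have trE : tr k l' = tr k l.
    apply/funext => x; apply/funext => n; rewrite /tr; case: ifP => // nk.
    by rewrite ll'// ltnW.
  split; [by rewrite -ll'|by move=> x; rewrite -ll'|].
  by move=> x; rewrite trE -ll'//; exact: lr.
- have ctr : continuous (tr k l).
    apply: prod_topology_continuous => n; rewrite /tr; case nk: (n < k)%N.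
      have [cl _ _] := lP n nk.
      exact: pair_continuous.
    exact: cst_continuous.
  have cc : continuous (fun x => c k (tr k l x)).
    move=> x; apply: (@continuous_comp _ _ _ (tr k l) (c k)); first exact: ctr.
    exact: c_cont.
  have cd : continuous (fun x => dist_set K (c k (tr k l x))).
    move=> x; apply: (@continuous_comp _ _ _ (fun x => c k (tr k l x)) (dist_set K)).
      exact: cc.
    exact: dist_set_continuous.
  pose A := [set x | dist_set K (c k (tr k l x)) <= e1].
  have [||x Ax|g [cg gK gA]] := XK A (fun x => r (c k (tr k l x))).
  + by apply: (@closed_comp _ _ _ [set u | u <= e1]) => // x _; exact: cd.
  + apply: continuous_in_subspaceT => x /set_mem Ax.
    apply: (@continuous_comp _ _ _ (fun x => c k (tr k l x)) r); first exact: cc.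
    by have [] := eP (le_lt_trans Ax e1_lt).
  + by have [] := eP (le_lt_trans Ax e1_lt).
  exists g; have trE : tr k (fun j => if (j < k)%N then l j else g) = tr k l.
    by apply/funext => x; apply/funext => n; rewrite /tr; case: ifP => // ->.
  split; rewrite ltnn; [exact: cg|exact: gK|].
  by move=> x; rewrite trE => xe; apply: gA; exact: ltW.
exists (fun x n => (pi n x, l n x)); split => //.
- apply: prod_topology_continuous => n; have [cl _ _] := lP n.
  exact: pair_continuous.
- move=> x; split=> [n|k]; first by have [_ lK _] := lP n; split; [exact: pi01|exact: lK].
  by have [_ _ lr] := lP k; exact: lr.
Qed.

(** Tietze's theorem extends [f] to [h] with values in [V], and some [c' k] is close to [h] on the
    box. The extension retracts [h] where [c' k] is near [K], is the coordinate [(t k).2] where it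
    is far, and interpolates in between. *)
Lemma universal_extends (A : set W) (f : W -> V) : closed A ->
  A `<=` universal_set -> {within A, continuous f} ->
  (forall t, A t -> K (f t)) ->
  exists g : W -> V, [/\ {within universal_set, continuous g},
    forall t, universal_set t -> K (g t) & forall t, A t -> g t = f t].
Proof.
move=> clA AU cf fK.
have fbound : exists M, forall t, A t -> forall j, `|f t 0 j| <= M.
  have [M [_ MK]] := compact_bounded K_compact.
  exists (M + 1) => t At j; apply: le_trans (MK (M + 1) _ _ (fK t At)).
    rewrite [leRHS]mx_normrE.
    exact: (le_bigmax _ (fun ij : 'I_1 * 'I_m => `|f t ij.1 ij.2|) (0, j)).
  by rewrite ltrDl.
have [h ch hf] := tietze_rV W_normal clA cf fbound.
have d0 : 0 < e1 / 8 by rewrite divr_gt0.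
have [q hq qc] := c_dense ch d0.
have cq : continuous q by have [n _ <-] := qc 0%N; exact: c_cont.
have [N qN] := trunc_approx cq d0.
(* Here [q] must recur in the sequence: [k] has to be so large that truncation hardly changes
   [q]. *)
have [k Nk ck] := qc N.
have hc t : hilbert_box t -> `|h t - c' k t| < e1 / 4.
  move=> Wt; rewrite (_ : h t - c' k t = (h t - q t) + (q t - q (trunc k t))).
    apply: le_lt_trans (ler_normD _ _) _.
    rewrite (_ : e1 / 4 = e1 / 8 + e1 / 8); last by field.
    by apply: ltrD; [exact: hq|exact: qN].
  by rewrite addrA subrK /c' ck.
pose d t := dist_set K (c' k t).
have dge0 t : 0 <= d t by exact: dist_set_ge0.
(* Equal to 1 for [d t <= e1 / 2] and to 0 for [d t >= 3 * e1 / 4]. *)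
pose lam t : R := clamp (3 - 4 / e1 * d t).
have clam : continuous lam.
  have cl : continuous (fun u : R => clamp (3 - 4 / e1 * u)).
    move=> u; apply: (@continuous_comp _ _ _ (fun u => 3 - 4 / e1 * u) (@clamp R)).
      apply: (@cvgB _ R^o); first exact: cvg_cst.
      by apply: cvgM; [exact: cvg_cst|exact: cvg_id].
    exact: clamp_continuous.
  by move=> t; apply: (@continuous_comp _ _ _ d _ t _ (cl (d t))); exact: d_cont.
have lam0 t : 0 <= lam t by exact: clamp_ge0.
have lam1 t : lam t <= 1 by exact: clamp_le1.
pose mix t : V := c' k t + lam t *: (h t - c' k t).
have cmix : continuous mix.
  have cdiff : continuous (fun t => h t - c' k t).
    by move=> t; apply: (@continuousB _ _ _ h (c' k)); [exact: ch|exact: c'_cont].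
  have cs : continuous (fun t => lam t *: (h t - c' k t)).
    by move=> t; apply: (@continuousZ _ _ _ lam); [exact: clam|exact: cdiff].
  by move=> t; apply: (@continuousD _ _ _ (c' k)); [exact: c'_cont|exact: cs].
have mix_close t : hilbert_box t -> d t < e1 -> dist_set K (mix t) < e.
  move=> Wt dt; apply: le_lt_trans (dist_set_lipschitz K0 (mix t) (c' k t)) _.
  rewrite (_ : mix t - c' k t = lam t *: (h t - c' k t)); last first.
    by rewrite /mix addrC addKr.
  rewrite normrZ ger0_norm//; apply: (@lt_le_trans _ _ (e1 + e1 / 4)).
    apply: ltr_leD => //; apply: le_trans (ltW (hc t Wt)).
    by rewrite ler_piMl.
  by rewrite /e1; move: e_gt0; lra.
(* The branches match when [d t] is between [3 * e1 / 4] and [e1]: there [mix t] is [c' k t], whose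
   retraction is [(t k).2] on [universal_set]. *)
pose g (t : W) := if d t < e1 then r (mix t) else (t k).2.
exists g; split.
- apply/subspace_continuousP => t [Wt tU].
  suff : g @ within universal_set (nbhs t) --> g t by [].
  have [dt|dt] := ltP (d t) e1.
    rewrite (_ : g t = r (mix t)); last by rewrite /g dt.
    have [rc _] := eP (mix_close t Wt dt).
    have : (r \o mix) @ within universal_set (nbhs t) --> r (mix t).
      by apply: cvg_within_filter; apply: continuous_comp; [exact: cmix|exact: rc].
    move=> H; refine (cvg_trans _ H); apply: near_eq_cvg.
    have : \forall s \near t, d s < e1.
      exact: (cvgr_lt _ (d_cont (k := k) (x := t)) _ dt).
    by apply: filterS => s ds _; rewrite /g ds.
  rewrite (_ : g t = (t k).2); last by rewrite /g ltNge dt.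
  have : (fun s : W => (s k).2) @ within universal_set (nbhs t) --> (t k).2.
    by apply: cvg_within_filter; exact: snd_cont.
  move=> H; refine (cvg_trans _ H); apply: near_eq_cvg.
  have dt' : e1 * 3 / 4 < d t by apply: lt_le_trans dt; rewrite ltr_pdivrMr//; lra.
  have : \forall s \near t, e1 * 3 / 4 < d s.
    exact: (cvgr_gt _ (d_cont (k := k) (x := t)) _ dt').
  apply: filterS => s ds [Ws Us]; rewrite /g; case: ifP => // ds1.
  rewrite Us//; congr r; rewrite /mix (_ : lam s = 0) ?scale0r ?addr0//.
  apply: clamp0; rewrite subr_le0 mulrAC ler_pdivlMr//; lra.
- move=> t [Wt tU]; rewrite /g; case: ifP => [dt|_]; last by have [] := Wt k.
  by have [] := eP (mix_close t Wt dt).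
- move=> t At; have [Wt tU] := AU t At.
  have dt : d t <= e1 / 4.
    apply: le_trans (dist_set_le _ (fK t At)) _.
    by rewrite distrC -hf// ltW// hc.
  rewrite /g ifT; last by apply: le_lt_trans dt _; rewrite ltr_pdivrMr//; lra.
  rewrite /mix (_ : lam t = 1).
    by rewrite scale1r addrC subrK hf// rK//; exact: fK.
  apply: clamp1; rewrite lerBrDr -lerBrDl mulrAC ler_pdivrMr//; lra.
Unshelve. all: by end_near.
Qed.

End universal_compactum.

(** On the compact [D] the map [q] is closed, hence a quotient map onto its image. *)
Lemma within_compact_image_continuous (Z W U : topologicalType) (D : set Z)
    (q : Z -> W) (f : W -> U) : compact D -> hausdorff_space W ->
  {within D, continuous q} -> {within D, continuous (f \o q)} ->
  {within q @` D, continuous f}.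
Proof.
move=> cD hW cq cf; apply/continuous_closedP => F clF.
move/continuous_closedP : cf => /(_ F clF)/closed_subspaceP[F' clF' F'E].
apply/closed_subspaceP; exists (q @` (F' `&` D)).
  apply: compact_closed => //; apply: continuous_compact.
    by apply: continuous_subspaceW cq => z [].
  by rewrite setIC; exact: compact_closedI.
apply/seteqP; split => w.
  move=> [[z F'z <-] _]; move: (F'z); rewrite F'E => -[Fz Dz].
  by split => //; exists z.
move=> [Fw [z Dz zw]]; split; last by exists z.
exists z => //; rewrite F'E; split => //=.
by rewrite -zw in Fw.
Qed.

Lemma compact_range_embedding (T W : topologicalType) (v : T -> W) :
  compact (range v) ->
  (forall t (B : set T), nbhs t B ->
    exists2 C : set W, nbhs (v t) C & v @^-1` C `<=` B) ->
  compact [set: T].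
Proof.
move=> cU vB F FF _.
have [|_ [[t _ <-] ct]] := cU (fmap v F) _.
  by rewrite /fmap /=; apply: filterS filterT => s _; exists s.
exists t; split => // A B FA /vB[C nC CB].
have [|_ [[s As <-] Cs]] := ct (v @` A) C _ nC.
  by rewrite /fmap /=; apply: filterS FA => s As; exists s.
by exists s; split => //; exact: CB.
Qed.

Section embedded.
Variables (R : realType) (m : nat) (L : topologicalType) (iota : L -> 'rV[R]_m).
Hypothesis L_compact : compact [set: L].
Hypothesis iota_cont : continuous iota.
Hypothesis iota_inj : injective iota.

Let K := range iota.

Lemma range_embedding_compact : compact K.
Proof. by apply: continuous_compact L_compact; exact: continuous_subspaceT. Qed.

Lemma embedding_continuous (Z : topologicalType) (g : Z -> L) :
  continuous (iota \o g) -> continuous g.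
Proof.
move=> cg; apply/continuous_closedP => F clF.
have -> : g @^-1` F = (iota \o g) @^-1` (iota @` F).
  apply/seteqP; split => z; first by exists (g z).
  by case=> l Fl /iota_inj lg; rewrite /preimage /= -lg.
apply: closed_comp => [z _|]; first exact: cg.
apply: compact_closed; first exact: norm_hausdorff.
apply: continuous_compact; first exact: continuous_subspaceT.
by rewrite -(setTI F); exact: compact_closedI.
Qed.

Lemma edim_extends_into (X : topologicalType) : edim_le X L -> extends_into X K.
Proof.
move=> dX A f clA cf fK.
have /choice[F FP] (a : A) : exists l, iota l = f (set_val a).
  by have [l _ <-] := fK _ (set_mem (valP a)); exists l.
have [|g cg gF] := dX A F clA.
  apply: embedding_continuous.
  rewrite (_ : iota \o F = sigL A f); last by apply/funext => a /=; rewrite FP.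
  exact/subspace_sigL_continuousP.
exists (iota \o g); split.
- by move=> x; apply: continuous_comp; [exact: cg|exact: iota_cont].
- by move=> x; exists (g x).
- by move=> x Ax; have := gF (SigSub (mem_set Ax)) => /= ->; rewrite FP.
Qed.

Lemma universal_compactum (l0 : L) (r : 'rV[R]_m -> 'rV[R]_m) :
  nbhd_retraction K r ->
  exists (T : metricType R) (p : nat -> T -> R), [/\ compact [set: T],
    edim_le T L, forall n, continuous (p n) &
    forall X : topologicalType, edim_le X L ->
      forall pi : nat -> X -> R, (forall n, continuous (pi n)) ->
      (forall n x, 0 <= pi n x <= 1) ->
      exists2 phi : X -> T, continuous phi & forall n x, p n (phi x) = pi n x].
Proof.
move=> rK; have K0 : K (iota l0) by exists l0.
have [e e0 eP] := nbhd_retraction_dist range_embedding_compact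
  (ex_intro _ _ K0) rK.
have cW := hilbert_box_compact range_embedding_compact.
have [c [cc c_dense]] := @dense_sequence R m _ _ cW.
pose U := universal_set K (iota l0) r e c.
have cU : compact U by apply: universal_set_compact => //; exact: range_embedding_compact.
have hW := @box_hausdorff R m.
pose W := prod_topology (fun _ : nat => (R * 'rV[R]_m)%type).
have [T [emb [cemb emb_inj embE embB]]] := @metrizable R W hW U.
have embU t : U (emb t) by rewrite -embE; exists t.
have cT : compact [set: T].
  by apply: compact_range_embedding embB; rewrite embE.
exists T, (fun n t => (emb t n).1); split => //.
- move=> A f clA cf.
  pose A' := emb @` A.
  have clA' : closed A'.
    apply: compact_closed => //; apply: continuous_compact.
      exact: continuous_subspaceT.
    by rewrite -(setTI A); exact: compact_closedI.
  (* [f] is transported to a total function on [W], which is well defined because [emb] is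
     injective. *)
  have /choice[f' f'P] (w : W) :
      exists v, forall a : A, emb (set_val a) = w -> v = iota (f a).
    have [[a aw]|na] := pselect (exists a : A, emb (set_val a) = w).
      by exists (iota (f a)) => b; rewrite -aw => /emb_inj/val_inj ->.
    by exists 0 => a aw; case: na; exists a.
  have f'E (a : A) : f' (emb (set_val a)) = iota (f a) by exact: f'P.
  have cf' : {within A', continuous f'}.
    apply: within_compact_image_continuous => //.
    - by rewrite -(setTI A); exact: compact_closedI.
    - exact: continuous_subspaceT.
    - apply/subspace_sigL_continuousP.
      rewrite (_ : sigL A (f' \o emb) = iota \o f); last first.
        by apply/funext => a; exact: f'E.
      by move=> a; apply: continuous_comp; [exact: cf|exact: iota_cont].
  have f'K w : A' w -> K (f' w).
    move=> [t At <-]; have := f'E (SigSub (mem_set At)) => /= ->.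
    by exists (f (SigSub (mem_set At))).
  have A'U : A' `<=` U by move=> _ [t _ <-].
  have [g [cg gK gf]] := universal_extends range_embedding_compact K0 rK.1 e0 eP
    cc c_dense clA' A'U cf' f'K.
  have /choice[G GP] (t : T) : exists l, iota l = g (emb t).
    by have [l _ <-] := gK _ (embU t); exists l.
  exists G.
    apply: embedding_continuous.
    rewrite (_ : iota \o G = g \o emb); last by apply/funext => t /=; rewrite GP.
    exact: within_comp_continuous cg cemb embU.
  move=> a; apply: iota_inj; rewrite GP -f'E; apply: gf.
  by exists (set_val a) => //; exact: (set_mem (valP a)).
- move=> n t; apply: (@continuous_comp _ _ _ (fun t => emb t n) fst).
    apply: (@continuous_comp _ _ _ emb (fun w : W => w n)); first exact: cemb.
    exact: (@proj_continuous nat (fun _ => (R * 'rV[R]_m)%type) n).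
  exact: cvg_fst.
- move=> X dX pi cpi pi01.
  have [phi [cphi phiU phiE]] := universal_lift K0 e0 eP cc
    (edim_extends_into dX) cpi pi01.
  have /choice[psi psiE] x : exists t, emb t = phi x.
    by move: (phiU x); rewrite -/U -embE => -[t _ <-]; exists t.
  exists psi; last by move=> n x; rewrite psiE phiE.
  move=> x B /embB[C nC CB].
  have : nbhs x (phi @^-1` C) by apply: cphi; rewrite -psiE.
  by apply: filterS => y Cy; apply: CB; rewrite /= psiE.
Qed.
End embedded.

(** * Finite CW complexes are neighbourhood retracts *)

Section euclidean_disc.
Variables (R : realType) (n : nat).
Implicit Types (v : 'rV[R]_n) (s : R).

Definition sqnorm v : R := \sum_j v 0 j ^+ 2.

Lemma sqnorm_ge0 v : 0 <= sqnorm v.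
Proof. by apply: sumr_ge0 => j _; exact: sqr_ge0. Qed.

Lemma sqnormZ s v : sqnorm (s *: v) = s ^+ 2 * sqnorm v.
Proof. by rewrite mulr_sumr; apply: eq_bigr => j _; rewrite mxE exprMn. Qed.

Lemma sqnorm_continuous : continuous sqnorm.
Proof.
have H (r : seq 'I_n) : continuous (fun v : 'rV[R]_n => \sum_(j <- r) v 0 j ^+ 2).
  elim: r => [|j r IH].
    rewrite (_ : (fun v => _) = fun=> 0); first exact: cst_continuous.
    by apply/funext => v; rewrite big_nil.
  rewrite (_ : (fun v => _) =
      (fun v : 'rV[R]_n => v 0 j * v 0 j) + (fun v => \sum_(j <- r) v 0 j ^+ 2)).
    move=> v; apply: (@continuousD _ R^o); last exact: IH.
    by apply: continuousM; exact: coord_continuous.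
  by apply/funext => v; rewrite big_cons expr2.
exact: H.
Qed.

(** The radial retraction of Euclidean space onto the closed unit disc. *)
Definition clip v : 'rV[R]_n := (Num.max 1 (Num.sqrt (sqnorm v)))^-1 *: v.

Let max_gt0 v : 0 < Num.max 1 (Num.sqrt (sqnorm v)).
Proof. by rewrite lt_max ltr01. Qed.

Lemma clip_continuous : continuous clip.
Proof.
pose M v := Num.max 1 (Num.sqrt (sqnorm v)).
have cM : continuous M.
  move=> v.
  apply: (@continuous_at_max R _ (fun=> 1) (fun v => Num.sqrt (sqnorm v))).
    exact: cst_continuous.
  apply: (@continuous_comp _ _ _ sqnorm Num.sqrt); first exact: sqnorm_continuous.
  exact: sqrt_continuous.
move=> v; apply: (@continuousZ _ _ _ (fun v => (M v)^-1) id); last exact: cvg_id.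
by apply: continuousV; [rewrite gt_eqF//; exact: max_gt0|exact: cM].
Qed.

Lemma clip_id v : sqnorm v <= 1 -> clip v = v.
Proof.
move=> v1; rewrite /clip max_l ?invr1 ?scale1r//.
by rewrite -sqrtr1 ler_wsqrtr.
Qed.

Lemma sqnorm_clip v : 1 <= sqnorm v -> sqnorm (clip v) = 1.
Proof.
move=> v1; have s1 : 1 <= Num.sqrt (sqnorm v) by rewrite -{1}sqrtr1 ler_wsqrtr.
rewrite sqnormZ max_r// exprVn sqr_sqrtr ?sqnorm_ge0// mulVf// gt_eqF//.
exact: lt_le_trans v1.
Qed.

Lemma sqnorm_clip_le1 v : sqnorm (clip v) <= 1.
Proof.
have [v1|/ltW v1] := leP (sqnorm v) 1; first by rewrite clip_id.
by rewrite sqnorm_clip.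
Qed.

Lemma closed_disc_compact : compact (closed_disc R n).
Proof.
apply: bounded_closed_compact.
  exists 1; split => // M M1 v v1 /=; rewrite [leLHS]mx_normrE.
  apply/bigmax_leP; split; first exact: ltW (lt_trans ltr01 M1).
  move=> [i j] _ /=; rewrite ord1; apply: le_trans (ltW M1).
  rewrite -(ler_pXn2r (_ : 0 < 2)%N)// ?nnegrE// expr1n real_normK ?num_real//.
  apply: le_trans v1; rewrite [leRHS](bigD1 j)//= lerDl.
  by apply: sumr_ge0 => k _; exact: sqr_ge0.
apply: (@closed_comp _ _ sqnorm [set u | u <= 1]) => // v _.
exact: sqnorm_continuous.
Qed.

Lemma clip_disc v : closed_disc R n (clip v).
Proof. exact: sqnorm_clip_le1. Qed.

Lemma closed_disc_cases v : closed_disc R n v -> open_disc R n v \/ unit_sphere R n v.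
Proof. by rewrite /closed_disc /= le_eqVlt => /orP[/eqP|]; [right|left]. Qed.

Section radial_extension.
Variables (V : normedModType R) (Phi : 'rV[R]_n -> V).
Hypothesis Phi_cont : {within closed_disc R n, continuous Phi}.

Lemma radial_extension_continuous : continuous (Phi \o clip).
Proof.
exact: within_comp_continuous Phi_cont clip_continuous clip_disc.
Qed.

(** For [v] on the sphere and [s >= 1], [clip (s *: v)] is [v] and the difference vanishes; near
    interior points the premise fails for small [d]. Compactness of the disc times [1,2] makes this
    uniform. *)
Lemma radial_extension_near_sphere (e : R) : 0 < e ->
  exists2 d : R, 0 < d & forall v s, closed_disc R n v -> 1 - sqnorm v < d ->
    1 <= s -> s <= 2 -> `|Phi (clip (s *: v)) - Phi v| < e.
Proof.
move=> e0; pose F (x : 'rV[R]_n * R) := Phi (clip (x.2 *: x.1)) - Phi (clip x.1).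
have cF : continuous F.
  move=> x; apply: (@continuousB _ _ _
      (fun x : 'rV[R]_n * R => Phi (clip (x.2 *: x.1))) (fun x => Phi (clip x.1))).
    apply: (@continuous_comp _ _ _ (fun x : 'rV[R]_n * R => x.2 *: x.1) (Phi \o clip)).
      by apply: cvgZ; [exact: cvg_snd|exact: cvg_fst].
    exact: radial_extension_continuous.
  apply: (@continuous_comp _ _ _ fst (Phi \o clip)); first exact: cvg_fst.
  exact: radial_extension_continuous.
have csq : continuous (fun x : 'rV[R]_n * R => sqnorm x.1).
  move=> x; apply: (@continuous_comp _ _ _ fst sqnorm); first exact: cvg_fst.
  exact: sqnorm_continuous.
have cB := compact_setX closed_disc_compact (@segment_compact R 1 2).
have H : \forall d \near 0^'+, closed_disc R n `*` `[1, 2]%classic `<=`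
    (fun x : 'rV[R]_n * R => 1 - sqnorm x.1 < d -> `|F x| < e).
  move/compact_near_coveringP : cB; apply=> -[v s] [/= v1].
  rewrite in_itv /= => /andP[s1 s2].
  have [vo|vs] := closed_disc_cases v1.
    have d0 : 0 < (1 - sqnorm v) / 2 by rewrite divr_gt0// subr_gt0.
    have nv : \forall x \near (v, s), (1 - sqnorm v) / 2 < 1 - sqnorm x.1.
      have cs : (fun x : 'rV[R]_n * R => 1 - sqnorm x.1) @ (v, s) --> 1 - sqnorm v.
        apply: (@cvgB _ R^o); first exact: cvg_cst.
        exact: (csq (v, s)).
      by apply: (cvgr_gt _ cs); rewrite gtr_pMr ?subr_gt0// invf_lt1// ltr1n.
    exists ([set x | (1 - sqnorm v) / 2 < 1 - sqnorm x.1],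
            [set d | d < (1 - sqnorm v) / 2]).
      by split => //; exact: nbhs_right_lt.
    move=> [x d] /= [xv dv] xd; exfalso.
    by have := lt_trans xv (lt_trans xd dv); rewrite ltxx.
  have sv : clip (s *: v) = v.
    have vs1 : sqnorm v = 1 by exact: vs.
    rewrite /clip sqnormZ vs1 mulr1 sqrtr_sqr ger0_norm; last exact: le_trans s1.
    by rewrite max_r// scalerA mulVf ?scale1r// gt_eqF// (lt_le_trans ltr01).
  have F0 : F (v, s) = 0 by rewrite /F /= sv clip_id ?subrr.
  have nF : \forall x \near (v, s), `|F x| < e.
    have : (fun x => `|F x|) @ (v, s) --> `|F (v, s)|.
      by apply: cvg_norm; exact: cF.
    by rewrite F0 normr0 => /cvgr_lt; apply.
  exists ([set x | `|F x| < e], setT); first by split => //; exact: filterT.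
  by move=> [x d] [].
have [d [d0 dP]] : exists d : R, 0 < d /\ closed_disc R n `*` `[1, 2]%classic `<=`
    (fun x : 'rV[R]_n * R => 1 - sqnorm x.1 < d -> `|F x| < e).
  near (0 : R)^'+ => d; exists d; split; near: d => //.
  exact: nbhs_right_gt.
exists d => // v s v1 vd s1 s2.
have := dP (v, s); rewrite /F /= (clip_id v1); apply => //.
by split => //=; rewrite in_itv /= s1 s2.
Unshelve. all: by end_near.
Qed.

End radial_extension.
End euclidean_disc.

(** * Attaching one cell to a neighbourhood retract *)

Section attach_cell.
Variables (R : realType) (V : normedModType R) (n : nat).
Variables (K0 : set V) (r0 : V -> V) (Phi : 'rV[R]_n -> V).
Variables (a : V -> R) (b : V -> 'rV[R]_n).
Hypothesis K0_closed : closed K0.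
Hypothesis r0P : nbhd_retraction K0 r0.
Hypothesis Phi_cont : {within closed_disc R n, continuous Phi}.
Hypothesis Phi_sphere : forall v, unit_sphere R n v -> K0 (Phi v).
Hypothesis a_cont : continuous a.
Hypothesis b_cont : continuous b.
Hypothesis a_cell : forall v, open_disc R n v -> a (Phi v) = 1 - sqnorm v.
Hypothesis b_cell : forall v, open_disc R n v -> b (Phi v) = (1 - sqnorm v) *: v.
Hypothesis a_K0 : forall z, K0 z -> a z = 0.

Let K := K0 `|` Phi @` closed_disc R n.

Let K_closed : closed K.
Proof.
apply: closedU => //; apply: compact_closed; first exact: norm_hausdorff.
by apply: continuous_compact => //; exact: closed_disc_compact.
Qed.

Let Kn0 : K !=set0.
Proof. by exists (Phi (clip 0)); right; exists (clip 0) => //; exact: clip_disc. Qed.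

Let aE v : closed_disc R n v -> a (Phi v) = 1 - sqnorm v.
Proof.
move=> /closed_disc_cases[/a_cell//|vs].
by rewrite a_K0; [rewrite [sqnorm v]vs subrr|exact: Phi_sphere].
Qed.

Let Psi := Phi \o @clip R n.
Let Psi_cont : continuous Psi. Proof. exact: radial_extension_continuous. Qed.
Let PsiK v : K (Psi v). Proof. by right; exists (clip v) => //; exact: clip_disc. Qed.

(* Vanishes exactly on [K0] and agrees with [a] on the open cell. *)
Let u z := Num.max 0 (a z) + dist_set K z.

Let u_cont : continuous u.
Proof.
move=> z; apply: (@continuousD _ R^o _ (fun z => Num.max 0 (a z)) (dist_set K)).
  by apply: (@continuous_at_max R _ (fun=> 0) a); [exact: cst_continuous|exact: a_cont].
exact: dist_set_continuous.
Qed.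

Let u_gt0 z : ~ K0 z -> 0 < u z.
Proof.
move=> nK0; rewrite lt_neqAle; apply/andP; split; last first.
  by apply: addr_ge0; [rewrite le_max lexx|exact: dist_set_ge0].
apply/negP => /eqP/esym/eqP; rewrite paddr_eq0 ?dist_set_ge0 ?le_max ?lexx//.
move=> /andP[/eqP az /eqP /(dist_set_eq0 Kn0 K_closed)].
case=> // -[v vd vz]; have [vo|vs] := closed_disc_cases vd; last first.
  by apply: nK0; rewrite -vz; exact: Phi_sphere.
have : 0 < a z by rewrite -vz a_cell// subr_gt0.
move=> az0; move: az; rewrite max_r ?(ltW az0)// => az.
by rewrite az ltxx in az0.
Qed.

Let u_K0 z : K0 z -> u z = 0.
Proof. by move=> Kz; rewrite /u a_K0// maxxx dist_set0 ?addr0//; left. Qed.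

Let u_cell v : open_disc R n v -> u (Phi v) = 1 - sqnorm v.
Proof.
move=> vo; rewrite /u a_cell// dist_set0 ?addr0.
  by rewrite max_r// subr_ge0 ltW.
by right; exists v => //; exact: ltW.
Qed.

Let cell_nK0 v : open_disc R n v -> ~ K0 (Phi v).
Proof.
move=> vo /a_K0; rewrite a_cell// => /eqP; rewrite subr_eq0 => /eqP v1.
by move: vo; rewrite /open_disc /= -/(sqnorm v) -v1 ltxx.
Qed.

(** Recovers the disc coordinate on the open cell, so that [pr] is a projection to the closed
    cell. *)
Let w z := clip ((u z)^-1 *: b z).
Let pr z := Phi (w z).
(** Distance to the new cell in units of [u], which plays the role of the distance to [K0]. *)
Let D z := `|z - pr z| / u z.
(** Grows from 1 to 2 as [D z] goes from 0 to 1/2: [q z] is pushed outwards and reaches the image of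
    the sphere at [D z = 1/2] if [w z] has Euclidean norm at least 1/2. *)
Let s z := 1 + clamp (2 * D z).
Let q z := Psi (s z *: w z).
(** Is 0 for [D z <= 1/2] and 1 for [D z >= 1], so [m] moves from [q z] to [z]. *)
Let beta z := clamp (2 * D z - 1).
Let m z := q z + beta z *: (z - q z).
Let g z := if `[< K0 z >] then z else if D z <= 2^-1 then q z else r0 (m z).

Let w_cont z : ~ K0 z -> {for z, continuous w}.
Proof.
move=> nK0; apply: (@continuous_comp _ _ _ (fun z => (u z)^-1 *: b z) (@clip R n)).
  apply: (@continuousZ _ _ _ (fun z => (u z)^-1) b); last exact: b_cont.
  by apply: continuousV; [rewrite gt_eqF// u_gt0|exact: u_cont].
exact: clip_continuous.
Qed.

Let pr_cont z : ~ K0 z -> {for z, continuous pr}.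
Proof.
move=> nK0; rewrite (_ : pr = Psi \o (fun z => (u z)^-1 *: b z))//.
apply: continuous_comp; last exact: Psi_cont.
apply: (@continuousZ _ _ _ (fun z => (u z)^-1) b); last exact: b_cont.
by apply: continuousV; [rewrite gt_eqF// u_gt0|exact: u_cont].
Qed.

Let D_cont z : ~ K0 z -> {for z, continuous D}.
Proof.
move=> nK0; apply: (@continuousM _ _ (fun z => `|z - pr z|) (fun z => (u z)^-1)).
  apply: (@continuous_comp _ _ _ (fun z => z - pr z) (fun y : V => `|y|)).
    2: exact: norm_continuous.
  by apply: (@continuousB _ _ _ id pr); [exact: cvg_id|exact: pr_cont].
by apply: continuousV; [rewrite gt_eqF// u_gt0|exact: u_cont].
Qed.

Let s_cont z : ~ K0 z -> {for z, continuous s}.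
Proof.
move=> nK0; have cl : continuous (fun x : R => 1 + clamp (2 * x)).
  have c2 : continuous (fun x : R => clamp (2 * x)).
    move=> x; apply: (@continuous_comp _ _ _ (fun x : R => 2 * x) (@clamp R)).
      by apply: cvgM; [exact: cvg_cst|exact: cvg_id].
    exact: clamp_continuous.
  by move=> x; apply: (@cvgD _ R^o); [exact: cvg_cst|exact: c2].
apply: (@continuous_comp _ _ _ D (fun x : R => 1 + clamp (2 * x))); first exact: D_cont.
exact: cl.
Qed.

Let q_cont z : ~ K0 z -> {for z, continuous q}.
Proof.
move=> nK0; apply: (@continuous_comp _ _ _ (fun z => s z *: w z) Psi).
  by apply: (@continuousZ _ _ _ s w); [exact: s_cont|exact: w_cont].
exact: Psi_cont.
Qed.

Let m_cont z : ~ K0 z -> {for z, continuous m}.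
Proof.
move=> nK0; have cl : continuous (fun x : R => clamp (2 * x - 1)).
  move=> x; apply: (@continuous_comp _ _ _ (fun x : R => 2 * x - 1) (@clamp R)).
    apply: (@cvgB _ R^o); last exact: cvg_cst.
    by apply: cvgM; [exact: cvg_cst|exact: cvg_id].
  exact: clamp_continuous.
apply: (@continuousD _ _ _ q); first exact: q_cont.
apply: (@continuousZ _ _ _ beta (fun z => z - q z)).
  apply: (@continuous_comp _ _ _ D (fun x : R => clamp (2 * x - 1))); first exact: D_cont.
  exact: cl.
by apply: (@continuousB _ _ _ id q); [exact: cvg_id|exact: q_cont].
Qed.

Let near_nK0 z : ~ K0 z -> \forall x \near z, ~ K0 x.
Proof. by move=> nK0; apply: open_nbhs_nbhs; split => //; exact: closed_openC. Qed.

Let g_lt z : ~ K0 z -> D z < 2^-1 -> {for z, continuous g} /\ K (g z).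
Proof.
move=> nK0 Dz; split; last by rewrite /g asboolF// ifT ?ltW//; exact: PsiK.
have := q_cont nK0; rewrite /prop_for /continuous_at.
rewrite {2}/g asboolF// ifT ?ltW//; apply: cvg_trans; apply: near_eq_cvg.
have nD : \forall x \near z, D x < 2^-1 by exact: (cvgr_lt _ (D_cont nK0)).
apply: filterS2 (near_nK0 nK0) nD => x nKx Dx.
by rewrite /g asboolF// ifT ?ltW.
Qed.

Let g_gt z : ~ K0 z -> 2^-1 < D z ->
  {for m z, continuous r0} /\ K0 (r0 (m z)) -> {for z, continuous g} /\ K (g z).
Proof.
move=> nK0 Dz [cr Kr].
have gz : g z = r0 (m z) by rewrite /g asboolF// leNgt Dz.
split; last by rewrite gz; left.
have : {for z, continuous (r0 \o m)} by apply: continuous_comp; [exact: m_cont|].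
rewrite /prop_for /continuous_at gz; apply: cvg_trans; apply: near_eq_cvg.
have nD : \forall x \near z, 2^-1 < D x by exact: (cvgr_gt _ (D_cont nK0)).
apply: filterS2 (near_nK0 nK0) nD => x nKx Dx.
by rewrite /g asboolF// leNgt Dx.
Qed.

(** The branches of [g] meet at [D z = 1/2]: there [m z = q z], and this point lies in [K0], where
    [r0] is the identity. *)
Let g_eq z : ~ K0 z -> D z = 2^-1 -> 4^-1 <= sqnorm (w z) ->
  {for z, continuous g} /\ K (g z).
Proof.
move=> nK0 Dz wz.
have gz : g z = q z by rewrite /g asboolF// Dz lexx.
split; last by rewrite gz; exact: PsiK.
have mz : m z = q z by rewrite /m /beta Dz divff// subrr clamp0// scale0r addr0.
have Kq : K0 (q z).
  apply: Phi_sphere; apply: sqnorm_clip; rewrite /s Dz divff// clamp1// sqnormZ.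
  by rewrite (_ : (1 + 1) ^+ 2 = 4 :> R); [move: wz; lra|ring].
have [r0q r0c] := r0P; have [cr _] := nbhs_singleton (r0c _ Kq).
have cqz := q_cont nK0.
have crm : {for z, continuous (r0 \o m)}.
  by apply: continuous_comp; [exact: m_cont|rewrite mz].
rewrite /prop_for /continuous_at gz => N nN.
have n1 : nbhs z (q @^-1` N) by exact: cqz.
have n2 : nbhs z ((r0 \o m) @^-1` N) by apply: crm; rewrite /= mz r0q.
rewrite nbhs_simpl /=.
near=> x.
have nKx : ~ K0 x by near: x; exact: near_nK0.
rewrite /= /g asboolF//; case: ifP => _; near: x; [exact: n1|exact: n2].
Unshelve. all: by end_near.
Qed.

(** [u] is small near [z0], so [D z <= 1] puts [pr z] close to [z0]. Then [a (pr z)] is small, that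
    is, [w z] is close to the sphere, where the radial push moves the image little. *)
Let near_K0 z0 e : K0 z0 -> 0 < e -> \forall z \near z0, ~ K0 z -> D z <= 1 ->
  `|q z - z0| < e /\ 4^-1 < sqnorm (w z).
Proof.
move=> Kz0 e0; have e20 : 0 < e / 2 by rewrite divr_gt0.
have [d d0 dP] := radial_extension_near_sphere Phi_cont e20.
pose d' := Num.min d (2^-1).
have d'0 : 0 < d' by rewrite lt_min d0 invr_gt0 ltr0n.
have /nbhs_ballP[t /= t0 tP] : \forall y \near z0, a y < d'.
  have az0 : a z0 < d' by rewrite a_K0.
  exact: (cvgr_lt _ (@a_cont z0) _ az0).
pose t' := Num.min t (e / 2).
have t'0 : 0 < t' by rewrite lt_min t0.
have t'2 : 0 < t' / 2 by rewrite divr_gt0.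
have nu : \forall z \near z0, u z < t' / 2.
  have uz0 : u z0 < t' / 2 by rewrite u_K0.
  exact: (cvgr_lt _ (@u_cont z0) _ uz0).
apply: filterS2 (nbhsx_ballx z0 _ t'2) nu => z; rewrite -ball_normE /= => zz0 uz nK0 Dz.
have uz0 := u_gt0 nK0.
have zp : `|z - pr z| < t' / 2.
  by apply: le_lt_trans uz; move: Dz; rewrite /D ler_pdivrMr// mul1r.
have z0p : `|z0 - pr z| < t'.
  rewrite (_ : z0 - pr z = (z0 - z) + (z - pr z)); last by rewrite addrA subrK.
  by rewrite (splitr t'); apply: le_lt_trans (ler_normD _ _) _; exact: ltrD.
have wd : closed_disc R n (w z) by exact: clip_disc.
have : a (pr z) < d'.
  by apply: tP; rewrite -ball_normE /=; apply: lt_le_trans z0p _; rewrite ge_min lexx.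
rewrite /pr aE// lt_min => /andP[wd1 wd2]; split; last lra.
rewrite (_ : q z - z0 = (q z - pr z) - (z0 - pr z)); last first.
  by rewrite opprB addrA subrK.
rewrite (splitr e); apply: le_lt_trans (ler_normB _ _) _; apply: ltrD.
  apply: dP => //; rewrite /s; first by rewrite lerDl clamp_ge0.
  by rewrite -[leRHS]/(1 + 1) lerD2l clamp_le1.
by apply: lt_le_trans z0p _; rewrite ge_min lexx orbT.
Qed.

Let m_D1 z : 1 <= D z -> m z = z.
Proof.
move=> Dz; rewrite /m /beta clamp1 ?scale1r; last by lra.
by rewrite addrC subrK.
Qed.

Let m_near z z0 e : `|q z - z0| < e -> `|z - z0| < e -> `|m z - z0| < e.
Proof.
move=> qz zz.
have b0 : 0 <= beta z by exact: clamp_ge0.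
have b1 : beta z <= 1 by exact: clamp_le1.
have mE : (1 - beta z) *: (q z - z0) + beta z *: (z - z0) =
    (q z - z0) + beta z *: (z - q z).
  rewrite scalerBl scale1r -addrA; congr (_ + _).
  by rewrite addrC -scalerBr opprB addrA subrK.
rewrite (_ : m z - z0 = (1 - beta z) *: (q z - z0) + beta z *: (z - z0)); last first.
  by rewrite mE /m addrAC.
apply: le_lt_trans (ler_normD _ _) _; rewrite !normrZ !ger0_norm ?subr_ge0//.
have [->|bn1] := eqVneq (beta z) 1; first by rewrite subrr mul0r add0r mul1r.
have b1' : 0 < 1 - beta z by rewrite subr_gt0 lt_neqAle bn1.
rewrite (_ : e = (1 - beta z) * e + beta z * e); last by rewrite -mulrDl subrK mul1r.
by apply: ltr_leD; [rewrite ltr_pM2l|rewrite ler_wpM2l// ltW].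
Qed.

(** [m z] is [z] when [D z >= 1], and otherwise a convex combination of [z] and [q z], both close to
    [z0]. *)
Let near_m z0 (P : set V) : K0 z0 -> nbhs z0 P ->
  \forall z \near z0, ~ K0 z -> P (m z).
Proof.
move=> Kz0 /nbhs_ballP[e /= e0 eP].
apply: filterS2 (near_K0 Kz0 e0) (nbhsx_ballx z0 _ e0) => z zq zz0 nK0.
apply: eP; have [D1|D1] := leP (D z) 1; last by rewrite m_D1// ltW.
have [qz _] := zq nK0 D1; rewrite -ball_normE /= distrC; apply: m_near => //.
by move: zz0; rewrite -ball_normE /= distrC.
Qed.

Lemma attach_cell_retraction : exists r, nbhd_retraction K r.
Proof.
have [r0K r0n] := r0P.
(* On the open cell [w] inverts [Phi], so [D] vanishes, nothing is pushed and [g] is the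
   identity. *)
have cellE v : open_disc R n v -> D (Phi v) = 0 /\ g (Phi v) = Phi v.
  move=> vo; have v1 : sqnorm v <= 1 by exact: ltW.
  have wv : w (Phi v) = v.
    rewrite /w u_cell// b_cell// scalerA mulVf ?scale1r ?clip_id//.
    by rewrite gt_eqF// subr_gt0.
  have Dv : D (Phi v) = 0 by rewrite /D /pr wv subrr normr0 mul0r.
  split => //; rewrite /g asboolF; last exact: cell_nK0.
  rewrite Dv ifT ?invr_ge0//; rewrite /q /s Dv mulr0 clamp0// addr0 scale1r wv.
  by rewrite /Psi /= clip_id.
have cases x : K x -> K0 x \/ exists2 v, open_disc R n v & x = Phi v.
  case=> [|[v vd <-]]; first by left.
  have [vo|vs] := closed_disc_cases vd; first by right; exists v.
  by left; exact: Phi_sphere.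
exists g; split => x /cases[Kx|[v vo ->]].
- by rewrite /g asboolT.
- by have [] := cellE v vo.
- have near_g z0 : K0 z0 -> {for z0, continuous g}.
    move=> Kz0 N; rewrite {1}/g asboolT// => /nbhs_ballP[e /= e0 eN].
    have n1 := near_K0 Kz0 e0.
    have n2 : \forall z \near z0, ~ K0 z -> ball z0 e (r0 (m z)).
      have [cr _] := nbhs_singleton (r0n _ Kz0).
      have cb : nbhs (r0 z0) (ball z0 e) by rewrite r0K//; exact: nbhsx_ballx.
      exact: (near_m Kz0 (cr _ cb)).
    have n3 := nbhsx_ballx z0 _ e0.
    rewrite nbhs_simpl /=; near=> z; apply: eN.
    have h1 : ~ K0 z -> D z <= 1 -> `|q z - z0| < e /\ 4^-1 < sqnorm (w z).
      by near: z.
    have h2 : ~ K0 z -> ball z0 e (r0 (m z)) by near: z.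
    have h3 : ball z0 e z by near: z.
    rewrite /g; case: asboolP => // nK0; case: ifP => Dz; last exact: h2.
    have [|qz _] := h1 nK0; first by apply: le_trans Dz _; rewrite invf_le1// ler1n.
    by rewrite -ball_normE /= distrC.
  have n1 := near_K0 Kx ltr01.
  have n2 := near_m Kx (r0n x Kx).
  apply: filterS2 n1 n2 => z h1 h2.
  have [Kz|nK0] := pselect (K0 z).
    by split; [exact: near_g|rewrite /g asboolT//; left].
  have [Dz|Dz|Dz] := ltgtP (D z) 2^-1.
  + exact: g_lt.
  + by apply: g_gt => //; exact: h2.
  + apply: g_eq => //; have [|_ wz] := h1 nK0; last exact: ltW.
    by rewrite Dz invf_le1// ler1n.
- have nK0 := cell_nK0 vo; have [Dv _] := cellE v vo.
  have nD : \forall x \near Phi v, D x < 2^-1.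
    have Dv' : D (Phi v) < 2^-1 by rewrite Dv invr_gt0.
    exact: (cvgr_lt _ (D_cont nK0) _ Dv').
  by apply: filterS2 (near_nK0 nK0) nD => z nKz Dz; exact: g_lt.
Unshelve. all: by end_near.
Qed.

End attach_cell.

(** * Embedding a finite complex and retracting onto it cell by cell *)

Section finite_CW.
Variables (R : realType) (L : topologicalType) (hL : finite_CW_complex R L).

Let I : finType := cw_cell hL.
Let dim (i : I) : nat := cw_dim i.
Let phi (i : I) : 'rV[R]_(dim i) -> L := cw_map hL i.
Arguments phi : clear implicits.
Let cell (i : I) : set L := phi i @` open_disc R (dim i).
Let ccell (i : I) : set L := phi i @` closed_disc R (dim i).
Let hausL : hausdorff_space L := cw_hausdorff hL.

Let cellP x : exists i, cell i x.
Proof.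
have : [set: L] x by [].
by rewrite -(cw_cover hL) => -[i _ ix]; exists i.
Qed.

Let cell_inj i j x : cell i x -> cell j x -> i = j.
Proof. by move=> ix jx; apply: (cw_disjoint (f := hL)) => //; exists x. Qed.

Let phi_inj i u v : open_disc R (dim i) u -> open_disc R (dim i) v ->
  phi i u = phi i v -> u = v.
Proof. by move=> uo vo; apply: (cw_inj (f := hL)); exact: mem_set. Qed.

Let cell_ccell i : cell i `<=` ccell i.
Proof. by move=> _ [v /= vo <-]; exists v => //; exact: ltW. Qed.

Let ccell_compact i : compact (ccell i).
Proof.
by apply: continuous_compact; [exact: cw_continuous|exact: closed_disc_compact].
Qed.

Let ccell_cases i x : ccell i x -> cell i x \/ exists2 j, (dim j < dim i)%N & cell j x.
Proof.
move=> [v /closed_disc_cases[vo|vs] <-]; first by left; exists v.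
right; have [|j /= ji jx] := @cw_boundary _ _ hL i (phi i v); first by exists v.
by exists j.
Qed.

Let skel (S : {set I}) : set L := \bigcup_(i in [set i | i \in S]) cell i.
Let downclosed (S : {set I}) := forall i j, i \in S -> (dim j < dim i)%N -> j \in S.

Let skel_closed S : downclosed S -> closed (skel S).
Proof.
move=> dS; have -> : skel S = \bigcup_(i in [set i | i \in S]) ccell i.
  apply/seteqP; split => x [i Si ix]; first by exists i => //; exact: cell_ccell.
  have [ix'|[j ji jx]] := ccell_cases ix; first by exists i.
  by exists j => //; exact: dS ji.
apply: closed_bigcup => [|i _]; first exact: finite_finset.
exact: compact_closed.
Qed.

Lemma finite_CW_compact : compact [set: L].
Proof.
have -> : [set: L] = \big[setU/set0]_(i in I) ccell i.
  rewrite -bigcup_pred; apply/seteqP; split => // x _.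
  by have [i /cell_ccell ix] := cellP x; exists i.
by apply: bigsetU_compact => i _; exact: ccell_compact.
Qed.

(** As [c] vanishes on the sphere, it extends by zero over the other cells of dimension at most
    [dim i]. These cells together with cell [i] form a closed set, and Tietze's theorem extends the
    function to [L]. *)
Let cell_function (i : I) (c : 'rV[R]_(dim i) -> R) : continuous c ->
  (forall v, unit_sphere R (dim i) v -> c v = 0) ->
  (exists M, forall v, closed_disc R (dim i) v -> `|c v| <= M) ->
  exists F : L -> R, [/\ continuous F,
    forall v, open_disc R (dim i) v -> F (phi i v) = c v &
    forall j x, j != i -> (dim j <= dim i)%N -> cell j x -> F x = 0].
Proof.
move=> cc c0 [M cM].
have /choice[G GP] x : exists y : R,
    (forall v, open_disc R (dim i) v -> phi i v = x -> y = c v) /\ (~ cell i x -> y = 0).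
  have [[v vo <-]|nx] := pselect (cell i x).
    exists (c v); split => [w wo /(phi_inj wo vo) -> //|[]].
    by exists v.
  by exists 0; split => // v vo vx; case: nx; exists v.
have GE v : closed_disc R (dim i) v -> G (phi i v) = c v.
  move=> /closed_disc_cases[vo|vs]; first by apply: (GP _).1.
  rewrite c0//; apply: (GP _).2 => iv.
  have [|j /= ji jv] := @cw_boundary _ _ hL i (phi i v); first by exists v.
  by have ij := cell_inj iv jv; rewrite -ij ltnn in ji.
have G0 j x : j != i -> cell j x -> G x = 0.
  move=> ji jx; apply: (GP _).2 => ix; move/eqP: ji; apply.
  exact: cell_inj jx ix.
pose S := [set j : I | (dim j <= dim i)%N]%SET.
have dS : downclosed S.
  by move=> j k; rewrite !inE => ji kj; apply: leq_trans (ltnW kj) ji.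
have dS' : downclosed (S :\ i).
  move=> j k; rewrite !inE => /andP[_ ji] kj.
  rewrite (leq_trans (ltnW kj) ji) andbT; apply: contraTneq kj => ->.
  by rewrite -leqNgt.
have cG : {within skel S, continuous G}.
  have -> : skel S = skel (S :\ i) `|` ccell i.
    apply/seteqP; split => x.
      move=> [j /= Sj jx]; have [ji|ji] := eqVneq j i.
        by right; apply: cell_ccell; rewrite -ji.
      by left; exists j => //=; rewrite in_setD1 ji.
    case=> [[j /= + jx]|]; first by rewrite in_setD1 => /andP[_ Sj]; exists j.
    move=> /ccell_cases[ix|[j ji jx]]; first by exists i => //=; rewrite inE.
    by exists j => //=; rewrite inE ltnW.
  apply: withinU_continuous; [exact: skel_closed|exact: compact_closed| |].
    apply: (@within_eq_continuous _ _ _ (fun=> 0)); last exact: cst_continuous.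
    by move=> x [j /=]; rewrite in_setD1 => /andP[ji _] /(G0 _ _ ji) ->.
  apply: within_compact_image_continuous => //; first exact: closed_disc_compact.
    exact: cw_continuous.
  by apply: (@within_eq_continuous _ _ _ c) => // v vd; rewrite /= GE.
have [||x Sx|F [FG cF _]] := @continuous_bounded_extension L R
  (compact_normal hausL finite_CW_compact) _ (skel_closed dS) G (`|M| + 1).
- by rewrite ltr_wpDl.
- exact: cG.
- have M0 : M <= `|M| + 1 by rewrite (le_trans (ler_norm _))// lerDl.
  have [[v vo <-]|nx] := pselect (cell i x).
    have vd : closed_disc R (dim i) v by exact: ltW.
    by rewrite GE//; apply: le_trans (cM v vd) M0.
  by rewrite (GP _).2// normr0 addr_ge0.
exists F; split => //.
- move=> v vo; rewrite -FG; last first.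
    by apply: mem_set; exists i; [rewrite /= inE|exists v].
  by apply: GE; exact: ltW.
- move=> j x ji dj jx; rewrite -FG; last first.
    by apply: mem_set; exists j => //=; rewrite inE.
  exact: G0 ji jx.
Qed.

Let cell_function_radius i : exists F : L -> R, [/\ continuous F,
    forall v, open_disc R (dim i) v -> F (phi i v) = 1 - sqnorm v &
    forall j x, j != i -> (dim j <= dim i)%N -> cell j x -> F x = 0].
Proof.
apply: (@cell_function i (fun v => 1 - sqnorm v)).
- move=> v; apply: (@continuousB _ R^o _ (fun=> 1) (@sqnorm R (dim i))).
    exact: cst_continuous.
  exact: sqnorm_continuous.
- by move=> v vs; rewrite [sqnorm v]vs subrr.
- exists 1 => v vd; rewrite ger0_norm; last by rewrite subr_ge0.
  by rewrite gerBl sqnorm_ge0.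
Qed.

Let cell_function_coord i k : exists F : L -> R, [/\ continuous F,
    forall v, open_disc R (dim i) v -> F (phi i v) = (1 - sqnorm v) * v 0 k &
    forall j x, j != i -> (dim j <= dim i)%N -> cell j x -> F x = 0].
Proof.
have c1 : continuous (fun v : 'rV[R]_(dim i) => 1 - sqnorm v).
  move=> v; apply: (@continuousB _ R^o _ (fun=> 1) (@sqnorm R (dim i))).
    exact: cst_continuous.
  exact: sqnorm_continuous.
have cc : continuous (fun v : 'rV[R]_(dim i) => (1 - sqnorm v) * v 0 k).
  move=> v; apply: (@continuousM _ _ (fun v : 'rV[R]_(dim i) => 1 - sqnorm v)).
    exact: c1.
  exact: coord_continuous.
apply: (@cell_function i (fun v => (1 - sqnorm v) * v 0 k)) => //.
- by move=> v vs; rewrite [sqnorm v]vs subrr mul0r.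
- have cD : compact ((fun v : 'rV[R]_(dim i) => (1 - sqnorm v) * v 0 k) @`
      closed_disc R (dim i)).
    apply: continuous_compact; first exact: continuous_subspaceT.
    exact: closed_disc_compact.
  have [M [_ MP]] := compact_bounded cD.
  exists (M + 1) => v vd; apply: (MP (M + 1)); first by rewrite ltrDl.
  by exists v.
Qed.

(* The coordinates of the embedding: for each cell the function [1 - |v|^2] and
   its products with the disc coordinates, extended by Tietze's theorem. *)
Let J : finType := {i : I & option 'I_(dim i)}.

(** Injectivity: the radius function of a cell is positive on it and zero on the other cells of no
    larger dimension, and the products then recover the disc coordinates. Retraction: by induction
    on the number of cells, a cell of maximal dimension is removed and attached again. *)
Lemma finite_CW_embedding : exists (m : nat) (iota : L -> 'rV[R]_m),
  [/\ continuous iota, injective iota &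
    exists r, nbhd_retraction (range iota) r].
Proof.
have /choice[F FP] (j : J) : exists F : L -> R, [/\ continuous F,
    forall v, open_disc R (dim (tag j)) v -> F (phi (tag j) v) =
      (1 - sqnorm v) * (if tagged j is Some k then v 0 k else 1) &
    forall k x, k != tag j -> (dim k <= dim (tag j))%N -> cell k x -> F x = 0].
  case: j => i [k|] /=; first exact: cell_function_coord.
  have [F [cF F1 F0]] := cell_function_radius i.
  by exists F; split => // v vo; rewrite mulr1 F1.
pose m := #|J|.
pose iota (x : L) : 'rV[R]_m := \row_(k < m) F (enum_val k) x.
pose crd (j : J) (z : 'rV[R]_m) : R := z 0 (enum_rank j).
have crdE j x : crd j (iota x) = F j x by rewrite /crd mxE enum_rankK.
have crd_cont j : continuous (crd j) by exact: coord_continuous.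
pose a i := crd (existT _ i None : J).
pose b i (z : 'rV[R]_m) : 'rV[R]_(dim i) := \row_k crd (existT _ i (Some k) : J) z.
have b_cont i : continuous (b i).
  by apply: row_continuous => k; exact: crd_cont.
have aE i v : open_disc R (dim i) v -> a i (iota (phi i v)) = 1 - sqnorm v.
  move=> vo; rewrite /a crdE.
  by have [_ /= -> //] := FP (existT _ i None : J); rewrite mulr1.
have bE i v : open_disc R (dim i) v -> b i (iota (phi i v)) = (1 - sqnorm v) *: v.
  move=> vo; apply/rowP => k; rewrite !mxE crdE.
  by have [_ /= -> //] := FP (existT _ i (Some k) : J).
have a0 i j x : j != i -> (dim j <= dim i)%N -> cell j x -> a i (iota x) = 0.
  by move=> ji dj jx; rewrite /a crdE; have [_ _ /(_ j x)->] := FP (existT _ i None : J).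
have iota_cont : continuous iota.
  by apply: row_continuous => k; have [] := FP (enum_val k).
have iota_inj : injective iota.
  move=> x y xy; have [i [u uo ux]] := cellP x; have [j [v vo vy]] := cellP y.
  wlog dij : x y xy i u uo ux j v vo vy / (dim j <= dim i)%N.
    move=> H; have [ij|/ltnW ji] := leqP (dim j) (dim i).
      exact: (H x y xy i u uo ux j v vo vy).
    exact/esym/(H y x (esym xy) j v vo vy i u uo ux).
  have u1 : 0 < 1 - sqnorm u by rewrite subr_gt0.
  have au := aE i u uo; rewrite ux xy in au.
  have ji : j = i.
    apply/eqP; apply: contraTT isT => ji; move: u1.
    by rewrite -au (a0 i j) ?ltxx//; exists v.
  rewrite -{}ji in u uo ux au u1 *.
  rewrite -vy aE// in au.
  have := bE j u uo; rewrite ux xy -vy bE// -au => /(scalerI (lt0r_neq0 _)) vu.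
  by rewrite -ux vu// au.
exists m, iota; split => //.
have iota_closed (A : set L) : closed A -> closed (iota @` A).
  move=> clA; apply: compact_closed; first exact: norm_hausdorff.
  apply: continuous_compact; first exact: continuous_subspaceT.
  by rewrite -(setTI A); apply: compact_closedI => //; exact: finite_CW_compact.
suff H S : downclosed S -> exists r, nbhd_retraction (iota @` skel S) r.
  have [|r rP] := H [set: I]%SET; first by move=> i j; rewrite !inE.
  exists r; rewrite (_ : range iota = iota @` skel [set: I]%SET)//.
  congr (iota @` _); apply/seteqP; split => // x _.
  by have [i ix] := cellP x; exists i => //=; rewrite inE.
have [k] := ubnP #|S|; elim: k S => // k IH S; rewrite ltnS => Sk dS.
have [->|/finset.set0Pn[i0 Si0]] := eqVneq S finset.set0.
  by exists id; split => [//|y [x [i /= +]]]; rewrite inE.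
case: (arg_maxnP dim Si0) => i iS imax; have Si : i \in S by exact: iS.
have dS' : downclosed (S :\ i).
  move=> j l; rewrite !inE => /andP[ji Sj] lj.
  rewrite (dS _ _ Sj lj) andbT; apply: contraTneq lj => ->.
  by rewrite -leqNgt; exact: imax.
have [|r0 r0P] := IH (S :\ i) _ dS'.
  by apply: leq_trans Sk; rewrite [X in (_ < X)%N](cardsD1 i) Si.
have [| | | | | | | | |r rP] := @attach_cell_retraction R _ (dim i)
  (iota @` skel (S :\ i)) r0 (iota \o phi i) (a i) (b i).
- exact/iota_closed/skel_closed.
- exact: r0P.
- apply: within_continuous_comp; last exact: cw_continuous.
  by move=> x _; exact: iota_cont.
- move=> v vs; have [|j /= ji jv] := @cw_boundary _ _ hL i (phi i v); first by exists v.
  exists (phi i v) => //; exists j => //=; rewrite !inE (dS _ _ Si ji) andbT.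
  by apply: contraTneq ji => ->; rewrite ltnn.
- exact: crd_cont.
- exact: b_cont.
- by move=> v vo; rewrite /= aE.
- by move=> v vo; rewrite /= bE.
- move=> _ [x [j /= + jx] <-]; rewrite !inE => /andP[ji Sj].
  by apply: (a0 i j) => //; exact: imax.
exists r; rewrite (_ : skel S = skel (S :\ i) `|` ccell i) ?image_setU; last first.
  apply/seteqP; split => x.
    move=> [j /= Sj jx]; have [ji|ji] := eqVneq j i.
      by right; apply: cell_ccell; rewrite -ji.
    by left; exists j => //=; rewrite in_setD1 ji.
  case=> [[j /= + jx]|]; first by rewrite in_setD1 => /andP[_ Sj]; exists j.
  move=> /ccell_cases[ix|[j ji jx]]; first by exists i.
  by exists j => //=; exact: dS ji.
by rewrite /ccell image_comp.
Qed.

End finite_CW.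

Theorem theorem2p9 (R : realType) (L X Y : topologicalType)
    (F : X -> set Y) (Fi : nat -> X -> set Y)
    (hL : finite_CW_complex R L)
    (hXpara : paracompact X) (hXC : C_space X) (hXdim : edim_le X L)
    (hF : multivalued F) (hFi : forall i : nat, multivalued (Fi i))
    (hfilt : filtration Fi F)
    (hconn : fiberwise_Lc_connected R L Fi)
    (hlsc : forall i : nat, strongly_lsc (Fi i)) :
  exists f : X -> Y, continuous_selection F f.
Proof.
have [[x0]|X0] := pselect (inhabited X); last first.
  have noX (x : X) : False by apply: X0; exists.
  exists (fun x => False_rect Y (noX x)); split => x; case: (noX x).
have [y0 _] := hF x0.
(* The empty map extends over [X], and the extension has a value at [x0]. *)
have [l0] : inhabited L.
  have nA (a : (set0 : set X)) : False by exact: (set_mem (valP a)).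
  have [||g _ _] := hXdim set0 (fun a => False_rect L (nA a)).
  - exact: closed0.
  - by move=> a; case: (nA a).
  exact: (inhabits (g x0)).
have [m [iota [ciota iota_inj [r rP]]]] := finite_CW_embedding hL.
have [T [p [cT dT cp lift]]] :=
  universal_compactum (finite_CW_compact hL) ciota iota_inj l0 rP.
have Fi_le x i j : (i <= j)%N -> Fi i x `<=` Fi j x.
  move=> /subnK <-; elim: (j - i)%N => // d IH y /IH; rewrite addSn.
  exact: (hfilt x).1.
have [f cf fP] := filtered_selection y0 Fi_le hconn hlsc hXpara cT dT cp hXC
  (lift X hXdim) x0.
exists f; split => // x; have [i fi] := fP x.
exact: (hfilt x).2 fi.
Qed.
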